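(* Let $n,m$ be non-negative integers and let $Q_0=[0,1]^{n+m}$. (1) For every $\epsilon>0$ there is a $\delta=\delta(\epsilon,n,m)>0$, depending only on $\epsilon,n,m$, with the following property. If $f\colon Q_0\to\ell^\infty$ is a $1$-Lipschitz map and $\mathcal{H}^{n,m}_\infty(f,Q_0)<\delta$, then there is a $1$-Lipschitz map $g\colon Q_0\to\ell^\infty$ such that $$\sup_{x\in Q_0}\|g(x)-f(x)\|_\infty<\epsilon$$ and $\mathcal{H}^{n,m}_\infty(g,Q_0)=0$. (2) Conversely, for every $\epsilon'>0$ there is a $\delta'=\delta'(\epsilon',n,m)>0$, depending only on $\epsilon',n,m$, such that if $f,g\colon Q_0\to\ell^\infty$ are $1$-Lipschitz maps, $\mathcal{H}^{n,m}_\infty(g,Q_0)=0$, and $$\sup_{x\in Q_0}\|g(x)-f(x)\|_\infty<\delta',$$ then $\mathcal{H}^{n,m}_\infty(f,Q_0)<\epsilon'$.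
   Context: Euclidean spaces and cubes carry the Euclidean metric; $\ell^\infty$ is the Banach space of bounded real sequences with the sup norm $\|\cdot\|_\infty$. Hausdorff content: for a subset $A$ of a metric space, $\mathcal{H}^k_\infty(A)=\inf\sum_{U\in\mathcal{U}}\operatorname{diam}(U)^k$, the infimum over all open covers $\mathcal{U}$ of $A$. Dyadic cubes in $[0,1]^d$: the closed cubes $Q=\prod_{i=1}^d[j_i2^{-k},(j_i+1)2^{-k}]\subseteq[0,1]^d$ with $k\ge 0$ and $j_i$ integers; the side length of such a cube is $\operatorname{side}(Q)=2^{-k}$. Mapping content: let $n,m$ be non-negative integers, $E\subseteq Q_0=[0,1]^{n+m}$, and $f$ a map from $Q_0$ to a metric space. The $(n,m)$-mapping content of $f$ on $E$ is $$\mathcal{H}^{n,m}_\infty(f,E)=\inf\sum_i\mathcal{H}^n_\infty(f(Q_i))\operatorname{side}(Q_i)^m,$$ the infimum over all coverings $\{Q_i\}$ of $E$ by dyadic cubes in $Q_0$ with pairwise disjoint interiors. *)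

(* Defs.v *)
From HB Require Import structures.
From mathcomp Require Import all_boot all_order all_algebra.
From mathcomp Require Import all_classical all_reals all_analysis.

Set Implicit Arguments.
Unset Strict Implicit.
Unset Printing Implicit Defensive.

Import Order.TTheory GRing.Theory Num.Theory.
Import numFieldNormedType.Exports.

Local Open Scope classical_set_scope.
Local Open Scope ring_scope.

Section EllInfty.
Variable R : realType.

Definition bounded_seq : {pred nat -> R^o} := fun u => `[< bounded_fun u >].

Lemma bounded_seqP (u : nat -> R^o) :
  reflect (exists M : R, forall i, `|u i| <= M) (u \in bounded_seq).
Proof.
apply: (iffP (asboolP _)) => [[M [Mreal uM]]|[M uM]].
  by exists (M + 1) => i; apply: uM => //; rewrite ltrDl.
exists M; split; first exact: num_real.
by move=> y My i _; apply: le_trans (uM i) (ltW My).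
Qed.

Lemma bounded_seq_submod_closed : submod_closed bounded_seq.
Proof.
split; first by apply/bounded_seqP; exists 0 => i; rewrite normr0.
move=> a u v /bounded_seqP[M uM] /bounded_seqP[N vN].
apply/bounded_seqP; exists (`|a| * M + N) => i.
apply: le_trans (ler_normD _ _) _; rewrite lerD //.
by apply: le_trans (_ : `|a| * `|u i| <= _); rewrite ?normrM ?ler_wpM2l.
Qed.

HB.instance Definition _ := GRing.isSubmodClosed.Build R (nat -> R^o) bounded_seq
  bounded_seq_submod_closed.

Record ell_infty := EllInfty {
  ell_infty_seq :> nat -> R^o;
  ell_inftyP : ell_infty_seq \in bounded_seq }.

HB.instance Definition _ := [isSub of ell_infty for ell_infty_seq].
HB.instance Definition _ := [Choice of ell_infty by <:].
HB.instance Definition _ := [SubChoice_isSubLmodule of ell_infty by <:].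

Definition ell_infty_norm (u : ell_infty) : R := sup (range (fun i => `|u i|)).

Lemma ell_infty_norm_has_sup (u : ell_infty) : has_sup (range (fun i => `|u i|)).
Proof.
split; first by exists `|u 0%N|; exists 0%N.
by have /bounded_seqP[M uM] := ell_inftyP u; exists M => _ [i _ <-].
Qed.

Lemma ell_infty_norm_ge (u : ell_infty) i : `|u i| <= ell_infty_norm u.
Proof. by apply: ub_le_sup; [case: (ell_infty_norm_has_sup u)|exists i]. Qed.

Lemma ell_infty_norm_le (u : ell_infty) M :
  (forall i, `|u i| <= M) -> ell_infty_norm u <= M.
Proof.
move=> uM; apply: ge_sup; first by case: (ell_infty_norm_has_sup u).
by move=> _ [i _ <-].
Qed.

Lemma ell_infty_normD (u v : ell_infty) :
  ell_infty_norm (u + v) <= ell_infty_norm u + ell_infty_norm v.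
Proof.
apply: ell_infty_norm_le => i.
by apply: le_trans (ler_normD _ _) _; rewrite lerD // ell_infty_norm_ge.
Qed.

Lemma ell_infty_normZ (a : R) (u : ell_infty) :
  ell_infty_norm (a *: u) = `|a| * ell_infty_norm u.
Proof.
have le_norm (b : R) (v : ell_infty) :
    ell_infty_norm (b *: v) <= `|b| * ell_infty_norm v.
  apply: ell_infty_norm_le => i; apply: le_trans (_ : `|b| * `|v i| <= _).
    by rewrite -normrM.
  by rewrite ler_wpM2l // ell_infty_norm_ge.
apply/eqP; rewrite eq_le le_norm /=; have [->|a0] := eqVneq a 0.
  rewrite normr0 mul0r.
  exact: le_trans (normr_ge0 ((0 *: u : ell_infty) 0%N)) (ell_infty_norm_ge _ _).
rewrite mulrC -ler_pdivlMr ?normr_gt0 // mulrC -normfV.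
by rewrite -{1}[u](scalerK a0).
Qed.

Lemma ell_infty_norm0_eq0 (u : ell_infty) : ell_infty_norm u = 0 -> u = 0.
Proof.
move=> u0; apply/val_inj/funext => i; apply/eqP.
by rewrite -normr_le0 -u0; exact: ell_infty_norm_ge.
Qed.

HB.instance Definition _ := Lmodule_isNormed.Build R ell_infty
  ell_infty_normD ell_infty_normZ ell_infty_norm0_eq0.

(* Makes ell_infty a metricType, with the topology and balls of its norm. *)
Definition ell_infty_dist (u v : ell_infty) : R := `|u - v|.

Lemma ell_infty_dist_ge0 u v : 0 <= ell_infty_dist u v.
Proof. exact: normr_ge0. Qed.

Lemma ell_infty_dist_positivity u v : ell_infty_dist u v = 0 -> u = v.
Proof. by move/normr0_eq0/eqP; rewrite subr_eq0 => /eqP. Qed.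

Lemma ell_infty_ballE (u : ell_infty) (r : R) :
  ball u r = [set v | ell_infty_dist u v < r].
Proof. by rewrite -ball_normE. Qed.

HB.instance Definition _ := PseudoMetric_isMetric.Build R ell_infty
  ell_infty_dist_ge0 ell_infty_dist_positivity ell_infty_ballE.

End EllInfty.

Section HausdorffContent.
Local Open Scope ereal_scope.
Context {R : realType} {X : metricType R}.

(* Inserting 0 only matters for U = set0, whose diameter is thus 0. *)
Definition diam (U : set X) : \bar R :=
  ereal_sup (0 |` [set (mdist xy.1 xy.2)%:E | xy in U `*` U]).

(* The library power satisfies 0 ^+ 0 = 1 and +oo ^+ 0 = 1, so for k = 0 every
   member of a cover counts 1; counting set0 as 0 instead would not change the
   infimum, since set0 can be dropped from any cover. *)
Definition hausdorff_content (k : nat) (A : set X) : \bar R :=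
  ereal_inf [set \esum_(U in UU) diam U ^+ k | UU in
    [set UU : set (set X) | UU `<=` open /\ A `<=` \bigcup_(U in UU) U]].

End HausdorffContent.

Section Cubes.
Variables (R : realType) (d : nat).

(* The norm of 'rV[R]_d in the library is the max norm; it induces the Euclidean
   topology, but not the Euclidean metric. *)
Definition euclidean_dist (x y : 'rV[R]_d) : R :=
  Num.sqrt (\sum_(i < d) (x 0 i - y 0 i) ^+ 2).

Definition unit_cube : set 'rV[R]_d := [set x | forall i, 0 <= x 0 i <= 1].

(* (k, j) encodes the closed cube \prod_i [j_i 2^-k, (j_i + 1) 2^-k]. Distinct
   indices give distinct cubes when d > 0; for d = 0 all of them give the single
   point of 'rV[R]_0, and side only occurs with exponent 0. *)
Definition dyadic_index : Type := (nat * 'rV[int]_d)%type.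

HB.instance Definition _ := Choice.on dyadic_index.

Definition dyadic_cube (q : dyadic_index) : set 'rV[R]_d :=
  [set x | forall i, (q.2 0 i)%:~R * 2 ^- q.1 <= x 0 i
                       <= (q.2 0 i + 1)%:~R * 2 ^- q.1].

Definition side (q : dyadic_index) : R := 2 ^- q.1.

Definition dyadic_covering (E : set 'rV[R]_d) (C : set dyadic_index) : Prop :=
  [/\ forall q, C q -> dyadic_cube q `<=` unit_cube,
      E `<=` \bigcup_(q in C) dyadic_cube q
    & trivIset C (fun q => interior (dyadic_cube q))].

End Cubes.

Arguments unit_cube R d : clear implicits.
Arguments dyadic_cube R {d} q.
Arguments side R {d} q.

Definition mapping_content (R : realType) (X : metricType R) (n m : nat)
    (f : 'rV[R]_(n + m) -> X) (E : set 'rV[R]_(n + m)) : \bar R :=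
  ereal_inf [set (\esum_(q in C)
      (hausdorff_content n (f @` dyadic_cube R q) * (side R q ^+ m)%:E)%E)
    | C in dyadic_covering E].

(* Maps defined on the unit cube are represented by total functions; only their
   values on the unit cube are ever used. *)
Definition one_lipschitz (R : realType) (d : nat) (X : metricType R)
    (f : 'rV[R]_d -> X) : Prop :=
  forall x y, unit_cube R d x -> unit_cube R d y ->
    mdist (f x) (f y) <= euclidean_dist x y.

Definition sup_dist (R : realType) (d : nat) (f g : 'rV[R]_d -> ell_infty R) :
    \bar R :=
  ereal_sup [set (`|f x - g x|)%:E | x in unit_cube R d].

(* Main.v *)
Require Import Defs.
From mathcomp Require Import all_boot all_order all_algebra finmap.
From mathcomp Require Import all_classical all_reals all_analysis.
From mathcomp Require Import ring lra zify.

(* A map f enters only through the pseudometric d x y = |f x - f y|, and such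
   pseudometrics, being uniformly Lipschitz, form a compact set. Call d separating
   on a box if, for some set I of n coordinates, d keeps the opposite I-faces of
   the box a positive distance apart.
   - A separating box bounds the mapping content below. On each n-dimensional
     slice of the box, the distances to the faces I map onto an n-cube
     (Poincare-Miranda); counting grid points of box and image then shows that any
     admissible sum of diam^n side^m is at least a multiple of the volume.
   - If d has no separating box, its mapping content is zero. Otherwise, by
     self-similarity, there are such d for which no subcube at any scale has small
     n-content. Blow-ups of these form a class closed under translations,
     dilations and limits. Any such class contains a seminorm: maximize the speed
     in a direction v, pass to a limit with maximal speed along a half-line, and
     translate along it to infinity, which makes the speed in direction v constant
     everywhere. A seminorm with no separating box has a kernel of dimension
     greater than m, so its unit cube does have small n-content.
   Being separating is stable under uniform perturbation. Hence a limit d of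
   pseudometrics of maps whose content tends to 0 has content 0, and so d has finite
   dyadic coverings with small sum, which serve all nearby pseudometrics as well;
   this is (2). For (1), McShane's formula turns a map whose pseudometric is close
   to d into a nearby map that is 1-Lipschitz for d. *)

Set Implicit Arguments.
Unset Strict Implicit.
Unset Printing Implicit Defensive.

Import Order.TTheory GRing.Theory Num.Theory.
Import numFieldNormedType.Exports.

(** * The discrete Poincare-Miranda theorem *)

Section DiscretePoincareMiranda.
Local Open Scope ring_scope.
Variable T : finType.
Implicit Types (x : T -> nat) (i j k : T) (S : {set T}) (s : seq T).
Implicit Types (F G : (T -> nat) -> 'F_2).

Definition upd x j (a : nat) : T -> nat := fun k => if k == j then a else x k.

Definition shift x j : T -> nat := fun k => (x k + (k == j))%N.

(** The forward difference in direction [j]; signs are immaterial in characteristic 2. *)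
Definition dif j F x : 'F_2 := F (shift x j) + F x.

Let add2 (a : 'F_2) : a + a = 0.
Proof. by apply: addrr_pchar2; apply: pchar_Fp. Qed.

Lemma shiftC x i j : shift (shift x i) j = shift (shift x j) i.
Proof. by apply: funext => k; rewrite /shift addnAC. Qed.

Lemma difM j F G x :
  dif j (fun y => F y * G y) x = dif j F x * G (shift x j) + F x * dif j G x.
Proof.
rewrite /dif; set a := F _; set b := F x; set c := G _; set d := G x.
by rewrite mulrDl mulrDr addrA -(addrA (a * c)) add2 addr0.
Qed.

Lemma dif_sum j (I : Type) (r : seq I) (P : pred I) (F : I -> (T -> nat) -> 'F_2) x :
  dif j (fun y => \sum_(i <- r | P i) F i y) x = \sum_(i <- r | P i) dif j (F i) x.
Proof. by rewrite /dif -big_split. Qed.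

(** The terms at (i, j) and (j, i) agree, so they cancel in characteristic 2. *)
Lemma sum_sym2 S (g : T -> T -> 'F_2) : (forall i j, g i j = g j i) ->
  \sum_(i in S) \sum_(j in S :\ i) g i j = 0.
Proof.
move=> gC.
have E i : \sum_(j in S :\ i) g i j =
    \sum_(j in S | (enum_rank i < enum_rank j)%N) g i j
    + \sum_(j in S | (enum_rank j < enum_rank i)%N) g i j.
  rewrite (bigID (fun j => (enum_rank i < enum_rank j)%N)) /=; congr (_ + _).
    apply: eq_bigl => j; rewrite !inE andbAC -andbA; case: (j \in S) => /=; rewrite ?andbF //.
    by case: (eqVneq j i) => [->|_] /=; rewrite ?ltnn ?andbT.
  apply: eq_bigl => j; rewrite !inE -leqNgt ltn_neqAle andbAC -andbA.
  case: (j \in S) => /=; rewrite ?andbF // ?andbT; congr (~~ _ && _).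
  by rewrite -(inj_eq (@enum_rank_inj T)).
under eq_bigr do rewrite E; rewrite big_split /=.
rewrite [X in _ + X](exchange_big_dep (mem S)) //=; last by move=> i j _ /andP[].
rewrite -[RHS](add2 (\sum_(i in S) \sum_(j in S | (enum_rank i < enum_rank j)%N) g i j)).
congr (_ + _); apply: eq_bigr => i iS; apply: eq_big => [j|j _]; first by rewrite iS /=.
exact: gC.
Qed.

Variable b : T -> (T -> nat) -> 'F_2.

(* Modulo 2, the coefficient of [\prod_(j in S) dx_j] in the cup product of the
   coboundaries of [b k], [k <- s], on the cubical complex of the grid. This
   product is closed, and Stokes' theorem computes its sum over the grid. *)
Fixpoint cup s S x : 'F_2 :=
  if s is k :: s' then \sum_(j in S) dif j (b k) x * cup s' (S :\ j) (shift x j)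
  else 1.

(** Induction on [s] with the Leibniz rule [difM]: the terms with a second difference of [b k] are
    symmetric in the two directions and cancel by [sum_sym2]; the others regroup around the
    induction hypothesis. *)
Lemma cup_closed s S x : \sum_(i in S) dif i (cup s (S :\ i)) x = 0.
Proof.
elim: s S x => [|k s IH] S x; first by apply: big1 => i _; rewrite /dif /= add2.
under eq_bigr => i _.
  rewrite (_ : dif i _ x = dif i (fun y => \sum_(j in S :\ i)
    dif j (b k) y * cup s (S :\ i :\ j) (shift y j)) x) // dif_sum.
  under eq_bigr do rewrite difM.
  rewrite big_split; over.
rewrite big_split /= [X in X + _]sum_sym2 ?add0r; last first.
  move=> i j; congr (_ * _); last by rewrite shiftC !finset.setDDl finset.setUC.
  rewrite /dif (shiftC x i j).
  by move: (b k _) (b k _) (b k _) (b k _) => a c d e; ring.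
rewrite (exchange_big_dep (mem S)) /=; last by move=> i j _ /finset.setD1P[].
apply: big1 => j jS.
transitivity (dif j (b k) x * \sum_(i in S :\ j) dif i (cup s (S :\ j :\ i)) (shift x j)).
  rewrite mulr_sumr; apply: eq_big => [i|i _].
    by rewrite !inE jS andbT andbC eq_sym.
  by rewrite /dif (shiftC x i j) !finset.setDDl (finset.setUC [set i]).
by rewrite IH mulr0.
Qed.

(** The product of a coboundary with a closed cochain is again a coboundary. In this form its sum
    over the grid telescopes to the faces. *)
Lemma cup_dif k s S x :
  cup (k :: s) S x = \sum_(j in S) dif j (fun y => b k y * cup s (S :\ j) y) x.
Proof.
rewrite /=; under [RHS]eq_bigr do rewrite difM.
by rewrite big_split /= -mulr_sumr cup_closed mulr0 addr0.
Qed.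

Variable K : nat.

Fixpoint box_sum s F x : 'F_2 :=
  if s is j :: s' then \sum_(a < K) box_sum s' F (upd x j a) else F x.

Lemma updC x i j a c : i != j -> upd (upd x i a) j c = upd (upd x j c) i a.
Proof.
move=> ij; apply: funext => k; rewrite /upd.
by case: (eqVneq k j) => // ->; rewrite eq_sym (negPf ij).
Qed.

Lemma box_sum_upd s j F x a : j \notin s ->
  box_sum s F (upd x j a) = box_sum s (fun y => F (upd y j a)) x.
Proof.
elim: s x => //= k s IH x; rewrite inE negb_or => /andP[jk js].
by apply: eq_bigr => c _; rewrite updC // IH.
Qed.

Lemma eq_box_sum s F G x : F =1 G -> box_sum s F x = box_sum s G x.
Proof. by move=> FG; elim: s x => //= j s IH x; apply: eq_bigr. Qed.

Lemma box_sum_sum s (I : Type) (r : seq I) (P : pred I) (F : I -> (T -> nat) -> 'F_2) x :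
  box_sum s (fun y => \sum_(i <- r | P i) F i y) x = \sum_(i <- r | P i) box_sum s (F i) x.
Proof.
elim: s x => //= j s IH x.
by under eq_bigr do rewrite IH; rewrite exchange_big.
Qed.

Lemma box_sum_rem s j F x : uniq s -> j \in s ->
  box_sum s F x = box_sum (rem j s) (fun y => \sum_(a < K) F (upd y j a)) x.
Proof.
elim: s x => //= k s IH x /andP[ks us]; rewrite inE.
case: (eqVneq j k) => [-> _|jk /= js].
  rewrite box_sum_sum; apply: eq_bigr => a _; exact: box_sum_upd.
by apply: eq_bigr => a _; exact: IH.
Qed.

Lemma sum_dif j F x :
  \sum_(a < K) dif j F (upd x j a) = F (upd x j K) + F (upd x j 0%N).
Proof.
elim: K => [|k IH]; first by rewrite big_ord0 add2.
rewrite big_ord_recr /= IH /dif.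
have -> : shift (upd x j k) j = upd x j k.+1.
  apply: funext => i; rewrite /shift /upd.
  by case: eqP => _; rewrite ?addn1 ?addn0.
by rewrite addrCA addrAC add2 add0r.
Qed.

Hypothesis b0 : forall k x, x k = 0%N -> b k x = 0.
Hypothesis bK : forall k x, x k = K -> b k x = 1.

(** On a face orthogonal to direction [j] the function [b j] is constant, so its coboundary, a
    factor of the product, vanishes there. *)
Lemma cup_face s S j x c : j \in s -> j \notin S ->
  (forall y, y j = x j -> b j y = c) -> cup s S x = 0.
Proof.
elim: s S x => //= k s IH S x; rewrite inE => js jS bj.
apply: big1 => i iS; have ij : j != i by apply: contraNneq jS => ->.
have xij : shift x i j = x j by rewrite /shift (negPf ij) addn0.
have [jk|jk] := eqVneq j k.
  by rewrite /dif -jk (bj _ xij) (bj x) // add2 mul0r.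
move: js; rewrite (negPf jk) /= => js.
rewrite IH ?mulr0 // ?inE ?(negPf jS) ?andbF // => y yx.
by apply: bj; rewrite yx.
Qed.

(** Stokes' theorem, by induction on [s]. After [cup_dif], summing in direction [j] leaves the two
    faces orthogonal to [j]. For [j != k] both contribute 0 by [cup_face]. For [j = k] the lower
    face has the factor [b k = 0], and the upper one, where [b k = 1], reproduces the sum for the
    rest of the list. *)
Lemma box_sum_cup s x : uniq s -> box_sum s (cup s [set k in s]) x = 1.
Proof.
elim: s x => // k s IH x ksu; have /andP[ks us] := ksu.
set S := [set k0 in k :: s].
rewrite (eq_box_sum _ _ (cup_dif k s _)) box_sum_sum.
rewrite (bigD1 k); last by rewrite !inE eqxx.
rewrite -[RHS](IH (upd x k K)) // -[RHS]addr0; congr (_ + _); last first.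
  apply: big1 => j /andP[+ jk]; rewrite !inE (negPf jk) orFb => js.
  rewrite (@box_sum_rem _ j) ?inE ?js ?orbT //.
  rewrite (@eq_box_sum _ _ (fun=> 0)) => [|y].
    by elim: (rem _ _) x => //= i t IHt x; apply: big1 => ? _; apply: IHt.
  rewrite sum_dif (@cup_face s _ j _ 1) ?inE ?eqxx // => [|z zK]; last first.
    by rewrite bK // zK /upd eqxx.
  rewrite (@cup_face s _ j _ 0) ?inE ?eqxx ?mulr0 ?addr0 // => z z0.
  by rewrite b0 // z0 /upd eqxx.
rewrite (@box_sum_rem _ k) ?inE ?eqxx //= eqxx box_sum_upd //.
apply: eq_box_sum => y; rewrite sum_dif bK ?b0 /upd ?eqxx // mul0r mul1r addr0.
congr (cup _ _ _); apply/setP => i; rewrite !inE.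
by case: eqVneq => //= ->; rewrite (negPf ks).
Qed.

Lemma box_sum_neq0 s F x : box_sum s F x != 0 ->
  exists2 y, F y != 0 & forall k, if k \in s then (y k < K)%N else y k == x k.
Proof.
elim: s F x => [|j s IH] F x /=; first by exists x => // k; rewrite eqxx.
have [/forallP H|/forallPn[a Ha _]] :=
  boolP [forall a : 'I_K, box_sum s F (upd x j a) == 0].
  by rewrite big1 ?eqxx // => a _; apply/eqP.
have [y Fy yx] := IH _ _ Ha; exists y => // k; rewrite inE.
have := yx k; rewrite /upd.
case: (eqVneq k j) => //= _; case: (k \in s) => // /eqP ->; exact: ltn_ord.
Qed.

(** A nonzero summand of the product is a lattice path through the unit cell at [x], with one edge
    for each member of [s]; the function attached to an edge changes along it. *)
Lemma cup_neq0 s S x : cup s S x != 0 -> forall k, k \in s ->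
  exists v w, [/\ b k v != b k w,
    forall j, (x j <= v j <= x j + (j \in S))%N &
    forall j, (x j <= w j <= x j + (j \in S))%N].
Proof.
elim: s S x => //= l s IH S x.
have [/forallP H|/forallPn[j]] := boolP [forall j, (j \in S) ==>
    (dif j (b l) x * cup s (S :\ j) (shift x j) == 0)].
  by rewrite big1 ?eqxx // => i iS; apply/eqP; have /implyP := H i; apply.
rewrite negb_imply mulf_eq0 negb_or => /and3P[jS dj cj] _ k.
have sx i : (x i <= shift x j i <= x i + (i \in S))%N.
  by rewrite /shift leq_addr leq_add2l; case: eqP => // ->; rewrite jS.
rewrite inE; case: eqVneq => [->|_ /= ks].
  exists (shift x j), x; split => // [|i]; last by rewrite leqnn leq_addr.
  by apply: contraNneq dj; rewrite /dif => ->; rewrite add2.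
have [v [w [vw vx wx]]] := IH _ _ cj k ks.
have mono u : (forall i, (shift x j i <= u i <= shift x j i + (i \in S :\ j))%N) ->
    forall i, (x i <= u i <= x i + (i \in S))%N.
  move=> ux i; have := ux i; rewrite !inE /shift.
  case: eqVneq => [->|_] /=; last by rewrite addn0.
  by rewrite jS addn0 => /andP[/(leq_trans (leq_addr _ _)) -> ->].
by exists v, w; split=> //; apply: mono.
Qed.

End DiscretePoincareMiranda.

(** The grid sum of the product is 1 modulo 2, so the product is nonzero at some cell. Only the
    coordinates in [S] vary, which gives a solution on every slice of the grid parallel to [S]. *)
Theorem discrete_poincare_miranda (T : finType) (K : nat) (S : {set T})
    (b : T -> (T -> nat) -> bool) (x : T -> nat) :
  (forall k y, y k = 0%N -> b k y = false) ->
  (forall k y, y k = K -> b k y = true) ->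
  exists2 y : T -> nat, (forall k, if k \in S then (y k < K)%N else y k == x k) &
    forall k, k \in S -> exists v w,
      [/\ b k v, ~~ b k w, forall j, (y j <= v j <= y j + (j \in S))%N &
         forall j, (y j <= w j <= y j + (j \in S))%N].
Proof.
move=> b0 bK; pose c k y : 'F_2 := (b k y : nat)%:R%R.
have c0 k y : y k = 0%N -> c k y = 0%R by move=> yk; rewrite /c b0.
have cK k y : y k = K -> c k y = 1%R by move=> yk; rewrite /c bK.
have us := enum_uniq S.
have /(congr1 (fun a => a != 0%R)) := box_sum_cup c0 cK x us.
rewrite oner_eq0 => /box_sum_neq0[y cy yx]; exists y => [k|k kS].
  by have := yx k; rewrite mem_enum.
have ks : k \in enum S by rewrite mem_enum.
have [v [w [vw vx wx]]] := cup_neq0 cy ks.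
have ES : [set k in enum S] = S by apply/setP => i; rewrite inE mem_enum.
rewrite ES in vx wx.
move: vw; rewrite /c; case bv: (b k v); case bw: (b k w); rewrite ?eqxx // => _.
  by exists v, w; rewrite bv bw.
by exists w, v; rewrite bv bw.
Qed.

Local Open Scope classical_set_scope.
Local Open Scope ring_scope.

(** * Pseudometrics and their ultralimits *)

Section Pseudometrics.
Variables (R : realType) (D : nat).
Notation V := 'rV[R]_D.
Implicit Types (d e : V -> V -> R) (p l x y z : V).

Definition box p l : set V := [set x | forall i, p 0 i <= x 0 i <= p 0 i + l 0 i].

Definition cube p (r : R) : set V := box p (const_mx r).

Lemma le_coord x (i : 'I_D) : `|x 0 i| <= `|x|.
Proof.
rewrite [leRHS]/Num.Def.normr /= mx_normrE.
by apply/bigmax_geP; right => /=; exists (0, i).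
Qed.

Lemma norm_le x (r : R) : 0 <= r -> (forall i, `|x 0 i| <= r) -> `|x| <= r.
Proof.
move=> r0 xr; rewrite [leLHS]/Num.Def.normr /= mx_normrE.
by apply: bigmax_le => // -[i j] _ /=; rewrite ord1.
Qed.

Lemma box_compact p l : compact (box p l).
Proof.
rewrite (_ : box p l = [set v | forall i, `[p 0 i, p 0 i + l 0 i]%classic (v ord0 i)]).
  apply: (@rV_compact R D (fun i => `[p 0 i, p 0 i + l 0 i]%classic)) => i.
  exact: segment_compact.
by apply/seteqP; split => x /= H i; have := H i; rewrite in_itv.
Qed.

(** The Lipschitz bound is for the max norm. [C] carries no sign condition, so its absolute value
    plus 1 often serves as a positive Lipschitz constant. *)
Definition pmetric (C : R) d : Prop :=
  [/\ forall x, d x x = 0, forall x y, d x y = d y x,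
      forall x y z, d x z <= d x y + d y z
    & forall x y, d x y <= C * `|x - y|].

Section PmetricTheory.
Variables (C : R) (d : V -> V -> R).
Hypothesis dP : pmetric C d.

Lemma pm_xx x : d x x = 0. Proof. by case: dP. Qed.
Lemma pm_sym x y : d x y = d y x. Proof. by case: dP. Qed.
Lemma pm_tri y x z : d x z <= d x y + d y z. Proof. by case: dP. Qed.
Lemma pm_lip x y : d x y <= C * `|x - y|. Proof. by case: dP. Qed.
Lemma pm_ge0 x y : 0 <= d x y.
Proof. by have := pm_tri y x x; rewrite pm_xx (pm_sym y); lra. Qed.

Lemma pm_quad x y x' y' : `|d x y - d x' y'| <= d x x' + d y y'.
Proof.
have := pm_tri x' x y; have := pm_tri y' x' y; have := pm_tri x x' y'.
have := pm_tri y x y'; rewrite (pm_sym y' y) (pm_sym x' x) ler_norml; lra.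
Qed.
End PmetricTheory.

Section Ultralimit.
Variable U : set_system nat.
Hypothesis UU : UltraFilter U.

(** The image ultrafilter clusters at a point of a compact segment, and an ultrafilter converges to
    each of its cluster points. *)
Lemma ultra_bounded_cvg (a : nat -> R) (M : R) :
  (forall j, `|a j| <= M) -> exists c : R, a @ U --> c.
Proof.
move=> aM; have /(_ (a @ U)) := @segment_compact R (- M) M.
have FI : U (fun j => `[- M, M]%classic (a j)).
  by apply: filterE => j /=; rewrite in_itv /= -ler_norml aM.
case=> [|c [_ cl]]; first exact: FI.
exists c => B Bl; rewrite /= /nbhs /=.
have [//|H] := in_ultra_setVsetC (a @^-1` B) UU.
have [r [nr Br]] : (~` B) `&` B !=set0 by exact: (cl _ _ H Bl).
by [].
Qed.

Definition ucvg (d_ : nat -> V -> V -> R) d :=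
  forall x y, (fun j => d_ j x y) @ U --> d x y.

(** Compactness of the class of pseudometrics: the ultrafilter provides the limits at all pairs of
    points at once. *)
Lemma pmetric_ulim C (d_ : nat -> V -> V -> R) :
  (forall j, pmetric C (d_ j)) -> exists2 d, pmetric C d & ucvg d_ d.
Proof.
move=> dP.
have H (xy : V * V) : exists c : R, (fun j => d_ j xy.1 xy.2) @ U --> c.
  apply: (@ultra_bounded_cvg _ (C * `|xy.1 - xy.2|)) => j.
  by rewrite ger0_norm ?(pm_lip (dP j)) // (pm_ge0 (dP j)).
have [f fP] := choice H; exists (fun x y => f (x, y)); last by move=> x y; exact: (fP (x, y)).
have cv x y := fP (x, y); split=> [x|x y|x y z|x y].
- rewrite -(cvg_lim _ (cv x x)) //=.
  under eq_fun do rewrite (pm_xx (dP _)).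
  by rewrite lim_cst.
- rewrite -(cvg_lim _ (cv x y)) // -(cvg_lim _ (cv y x)) //=.
  by under eq_fun do rewrite (pm_sym (dP _)).
- apply: (ler_cvg_to (cv x z) (cvgD (cv x y) (cv y z))).
  by apply: nearW => j; exact: (pm_tri (dP j)).
- apply: (cvgr_to_le (cv x y)).
  by apply: nearW => j; exact: (pm_lip (dP j)).
Qed.

(** Pointwise convergence of equi-Lipschitz functions is uniform on compact sets. *)
Lemma ucvg_unif C (d_ : nat -> V -> V -> R) d (K : set V) (e : R) :
  (forall j, pmetric C (d_ j)) -> pmetric C d -> ucvg d_ d -> compact K -> 0 < e ->
  \forall j \near U, forall x y, K x -> K y -> `|d_ j x y - d x y| <= e.
Proof.
move=> dP dP' dd cK e0.
have /compact_near_coveringP H := compact_setX cK cK.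
have C1 : 0 < `|C| + 1 by rewrite ltr_wpDl.
have lip c : pmetric C c -> forall x y, c x y <= (`|C| + 1) * `|x - y|.
  move=> cP x y; apply: le_trans (pm_lip cP x y) _.
  by rewrite ler_wpM2r // (le_trans (ler_norm _)) // lerDl.
have {}H : \forall j \near U,
    K `*` K `<=` (fun xy => `|d_ j xy.1 xy.2 - d xy.1 xy.2| <= e).
  apply: (H nat U (fun j xy => `|d_ j xy.1 xy.2 - d xy.1 xy.2| <= e)).
  (* Moving both points by less than [r] changes each of the two pseudometrics by at most e / 4,
     which leaves e / 2 for the convergence at (x, y). *)
  move=> -[x y] [Kx Ky]; pose r := e / (`|C| + 1) / 8.
  have r0 : 0 < r by rewrite !divr_gt0.
  have /cvgrPdist_le/(_ _ (divr_gt0 e0 (ltr0Sn R 1))) dxy := dd x y.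
  exists ([set w | ball x r w.1 /\ ball y r w.2], [set j | `|d x y - d_ j x y| <= e / 2%:R]).
    split=> //; exists (ball x r, ball y r); last by case.
    by split; exact: nbhsx_ballx.
  move=> [[x' y'] j] /= [[xx' yy'] dj].
  rewrite -ball_normE /= in xx'; rewrite -ball_normE /= in yy'.
  have q c : pmetric C c -> `|c x y - c x' y'| <= e / 4.
    move=> cP; apply: le_trans (pm_quad cP _ _ _ _) _.
    apply: le_trans (lerD (lip _ cP _ _) (lip _ cP _ _)) _.
    rewrite -mulrDr (_ : e / 4 = (`|C| + 1) * (r + r)).
      by rewrite ler_pM2l // lerD // ltW.
    by rewrite /r; field; rewrite gt_eqF.
  have := q _ dP'; have := q _ (dP j); move: dj.
  rewrite !ler_norml; lra.
apply: filterS H => j H x y Kx Ky; exact: (H (x, y)).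
Qed.
End Ultralimit.
End Pseudometrics.

(** Continuity at 0, used to absorb a small error in all terms of a finite sum of products at
    once. *)
Lemma horner_lt_near0 (R : realType) (p : {poly R}) (t : R) :
  p.[0] < t -> exists2 eta : R, 0 < eta & p.[eta] < t.
Proof.
move=> pt; have /nbhs_ballP[r /= r0 H] : \forall y \near (0 : R), p.[y] < t.
  exact: cvgr_lt _ (@continuous_horner R p 0) _ pt.
exists (r / 2); first by rewrite divr_gt0.
by apply: H; rewrite -ball_normE /= sub0r normrN gtr0_norm; lra.
Qed.

(** * Separating boxes and thin sets *)

Section SeparatedThin.
Variables (R : realType) (D n : nat).
Notation V := 'rV[R]_D.
Implicit Types (d e : V -> V -> R) (p l x y z : V) (I : {set 'I_D}) (A B : set V).

Definition separating d p l I (c : R) := forall k, k \in I -> forall x y,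
  box p l x -> box p l y -> x 0 k = p 0 k -> y 0 k = p 0 k + l 0 k -> c <= d x y.

Definition nonseparated A d := forall p l I c, (forall i, 0 < l 0 i) ->
  #|I| = n -> 0 < c -> box p l `<=` A -> ~ separating d p l I c.

(** A finite form of the statement that the n-dimensional content of [A] for [d] is less than [t].
    Finiteness and the strict inequality make it stable under small uniform changes of [d]. *)
Definition thin d A (t : R) := exists N (F : 'I_N -> set V) (r : 'I_N -> R),
  [/\ forall i, 0 <= r i, A `<=` \bigcup_i F i,
      forall i x y, A x -> A y -> F i x -> F i y -> d x y <= r i
    & \sum_i r i ^+ n < t].

Lemma thin_sub d A B t s : A `<=` B -> t <= s -> thin d B t -> thin d A s.
Proof.
move=> AB ts [N [F [r [r0 BF Fr rt]]]]; exists N, F, r; split=> //.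
- exact: subset_trans BF.
- by move=> i x y /AB Bx /AB By; exact: Fr.
- exact: lt_le_trans ts.
Qed.

Lemma thin_perturb d A t : thin d A t -> exists2 eta, 0 < eta &
  forall d', (forall x y, A x -> A y -> d' x y <= d x y + eta) -> thin d' A t.
Proof.
move=> [N [F [r [r0 AF Fr rt]]]].
(* Enlarging all diameter bounds by [eta] turns their sum into a polynomial in [eta]. *)
have [|eta eta0 H] := @horner_lt_near0 R (\sum_i ((r i)%:P + 'X) ^+ n) t.
  by rewrite horner_sum; under eq_bigr do rewrite !hornerE.
exists eta => // d' d'P; exists N, F, (fun i => r i + eta); split=> //.
- by move=> i; rewrite addr_ge0 // ltW.
- by move=> i x y Ax Ay Fx Fy; rewrite (le_trans (d'P _ _ Ax Ay)) // lerD2r (Fr i).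
- by move: H; rewrite horner_sum; under eq_bigr do rewrite !hornerE.
Qed.

Variable U : set_system nat.
Hypothesis UU : UltraFilter U.

Section Limit.
Variables (C : R) (d_ : nat -> V -> V -> R) (d : V -> V -> R).
Hypotheses (dP : forall j, pmetric C (d_ j)) (dP' : pmetric C d) (dd : ucvg U d_ d).

Lemma separating_ulim p l I c : 0 < c -> separating d p l I c ->
  \forall j \near U, separating (d_ j) p l I (c / 2).
Proof.
move=> c0 H; have c20 : 0 < c / 2 by rewrite divr_gt0.
have := ucvg_unif UU dP dP' dd (@box_compact R D p l) c20.
apply: filterS => j Hj k kI x y bx by_ xk yk.
have := H k kI x y bx by_ xk yk; have := Hj x y bx by_.
rewrite ler_norml; lra.
Qed.

Lemma thin_ulim A p l t : A `<=` box p l -> thin d A t ->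
  \forall j \near U, thin (d_ j) A t.
Proof.
move=> Ab /thin_perturb[eta eta0 H].
have := ucvg_unif UU dP dP' dd (@box_compact R D p l) eta0.
apply: filterS => j Hj; apply: H => x y /Ab bx /Ab by_.
have := Hj x y bx by_; rewrite ler_norml; lra.
Qed.

(** Separation by a given box is an open condition, hence nonseparation is a closed one. *)
Lemma nonseparated_ulim A : (\forall j \near U, nonseparated A (d_ j)) -> nonseparated A d.
Proof.
move=> H p l I c l0 In c0 bA Hs.
have [j [Hj]] := filter_ex (filterI H (separating_ulim c0 Hs)).
by apply: Hj => //; rewrite divr_gt0.
Qed.
End Limit.

End SeparatedThin.

(** * Seminorms in tangent classes *)

Lemma ler_eps (R : realType) (a b : R) : (forall eps : R, 0 < eps -> a <= b + eps) -> a <= b.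
Proof. by move=> H; apply/ler_addgt0Pr. Qed.

Section Seminorm.
Variables (R : realType) (D : nat) (C : R).
Notation V := 'rV[R]_D.
Implicit Types (d e : V -> V -> R) (v x y z : V) (K : set (V -> V -> R)).
Variable U : set_system nat.
Hypotheses (UU : UltraFilter U) (Uoo : \oo `<=` U).

Definition translate a d : V -> V -> R := fun x y => d (x + a) (y + a).

Definition dilate (s : R) d : V -> V -> R := fun x y => s * d (s^-1 *: x) (s^-1 *: y).

(** The last field asks for membership in [K] only for [U]-most indices, so that a diagonal sequence
    through decreasing classes has its limit in all of them. *)
Record tangent_class K : Prop := TangentClass {
  tc_pm : forall d, K d -> pmetric C d;
  tc_translate : forall a d, K d -> K (translate a d);
  tc_dilate : forall s d, 0 < s -> K d -> K (dilate s d);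
  tc_ulim : forall (d_ : nat -> V -> V -> R) d, (forall j, pmetric C (d_ j)) -> (\forall j \near U, K (d_ j)) ->
    pmetric C d -> ucvg U d_ d -> K d }.

Lemma pmetric_translate a d : pmetric C d -> pmetric C (translate a d).
Proof.
move=> dP; split=> [x|x y|x y z|x y]; rewrite /translate.
- exact: pm_xx dP _.
- exact: pm_sym dP _ _.
- exact: pm_tri dP _ _ _.
- by apply: le_trans (pm_lip dP _ _) _; rewrite opprD addrACA subrr addr0.
Qed.

Lemma pmetric_dilate s d : 0 < s -> pmetric C d -> pmetric C (dilate s d).
Proof.
move=> s0 dP; split=> [x|x y|x y z|x y]; rewrite /dilate.
- by rewrite (pm_xx dP) mulr0.
- by rewrite (pm_sym dP).
- by rewrite -mulrDr ler_pM2l // (pm_tri dP).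
- rewrite mulrC -ler_pdivlMr //; apply: le_trans (pm_lip dP _ _) _.
  by rewrite -scalerBr normrZ gtr0_norm ?invr_gt0 // mulrA mulrAC.
Qed.

Definition max_speed K v : R := sup [set d 0 v | d in K].

Definition constant_speed v (S : R) d := forall x t, 0 <= t -> d x (x + t *: v) = t * S.

Section Step.
Variables (K : set (V -> V -> R)) (v : V).
Hypotheses (KP : tangent_class K) (K0 : K !=set0).
Local Notation S := (max_speed K v).

Lemma has_sup_speed : has_sup [set d 0 v | d in K].
Proof.
split; first by have [d Kd] := K0; exists (d 0 v), d.
exists (C * `|v|) => _ [d Kd <-]; apply: le_trans (pm_lip (tc_pm KP Kd) _ _) _.
by rewrite sub0r normrN.
Qed.

(** Translation moves [x] to 0 and dilation by the inverse of [t] reduces to the vector [v]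
    itself. *)
Lemma le_max_speed d x t : K d -> 0 <= t -> d x (x + t *: v) <= t * S.
Proof.
move=> Kd; rewrite le_eqVlt => /predU1P[<-|t0].
  by rewrite scale0r addr0 (pm_xx (tc_pm KP Kd)) mul0r.
have ti0 : 0 < t^-1 by rewrite invr_gt0.
have K' := tc_dilate KP ti0 (tc_translate KP x Kd).
have : dilate t^-1 (translate x d) 0 v <= S.
  by apply: sup_upper_bound; [exact: has_sup_speed|exists (dilate t^-1 (translate x d))].
by rewrite /dilate /translate invrK scaler0 add0r addrC ler_pdivrMl.
Qed.

Lemma max_speed_attained : exists2 d, K d & d 0 v = S.
Proof.
have H j : exists d, K d /\ S - j.+1%:R^-1 < d 0 v.
  have /sup_adherent/(_ has_sup_speed) : 0 < (j.+1%:R : R)^-1 by rewrite invr_gt0.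
  by case=> _ [d Kd <-] dj; exists d.
have [d_ d_P] := choice H.
have pmj j : pmetric C (d_ j) by apply: tc_pm KP _ (d_P j).1.
have [d dP dd] := pmetric_ulim UU pmj.
have Kj : \forall j \near U, K (d_ j) by apply: filterE => j; exact: (d_P j).1.
have Kd : K d := tc_ulim KP pmj Kj dP dd.
exists d => //; apply/eqP; rewrite eq_le; apply/andP; split.
  by have := le_max_speed 0 Kd ler01; rewrite add0r scale1r mul1r.
apply: ler_eps => eps eps0; rewrite -lerBlDr.
apply: (cvgr_to_ge (dd 0 v)).
have : \forall j \near U, (j.+1%:R : R)^-1 < eps.
  by apply: Uoo; apply: near_infty_natSinv_lt (PosNum eps0).
apply: filterS => j je; apply: le_trans (ltW (d_P j).2).
by rewrite lerD2l lerN2 ltW.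
Qed.

(** If [d 0 v] is maximal, the triangle inequality forces the maximal speed on all initial parts of
    the segment from 0 to [v]. Dilations by j + 1 stretch this segment to a half-line. *)
Lemma half_line_speed : exists2 d, K d & forall t, 0 <= t -> t * S <= d 0 (t *: v).
Proof.
have [d Kd dS] := max_speed_attained; have dP := tc_pm KP Kd.
have d1 t : 0 <= t -> t <= 1 -> t * S <= d 0 (t *: v).
  move=> t0 t1; have := pm_tri dP (t *: v) 0 v; rewrite dS.
  have t1' : 0 <= 1 - t by rewrite subr_ge0.
  have := le_max_speed (t *: v) Kd t1'.
  by rewrite -scalerDl addrC subrK scale1r; lra.
have Kj j : K (dilate j.+1%:R d) by apply: tc_dilate.
have pmj j := tc_pm KP (Kj j).
have [e eP de] := pmetric_ulim UU pmj; exists e.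
  by refine (tc_ulim KP pmj _ eP de); apply: filterE.
move=> t t0; apply: (cvgr_to_ge (de 0 (t *: v))).
have : \forall j \near U, t <= (j.+1%:R : R).
  apply: Uoo; near=> j; rewrite -natr1 ler_wpDr //; near: j.
  exact: nbhs_infty_ger.
apply: filterS => j tj; rewrite /dilate scaler0 scalerA.
rewrite -ler_pdivrMl // mulrA; apply: d1; first by rewrite mulr_ge0 ?invr_ge0.
by rewrite ler_pdivrMl // mulr1.
Unshelve. all: by end_near.
Qed.

(** The translates along [v] of a pseudometric from [half_line_speed] converge to one that has the
    maximal speed from every base point. *)
Lemma constant_speed_nonempty : (K `&` constant_speed v S) !=set0.
Proof.
have [e Ke eS] := half_line_speed; have eP := tc_pm KP Ke.
have Kj j : K (translate (j%:R *: v) e) by apply: tc_translate.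
have pmj j := tc_pm KP (Kj j).
have [d dP ed] := pmetric_ulim UU pmj.
have Kd : K d by refine (tc_ulim KP pmj _ dP ed); apply: filterE.
exists d; split=> // z t t0; apply/eqP; rewrite eq_le le_max_speed //=.
(* [h] is nondecreasing and bounded, so its increments tend to 0 along the half-line. *)
pose h T := T * S - e z (z + T *: v).
have hs : has_sup (h @` [set T | 0 <= T]).
  split; first by exists (h 0); exists 0 => //=.
  (* The half-lines from 0 and from [z] stay at distance at most C times the norm of [z], and this
     is lost once at either end. *)
  exists (C * `|z| + C * `|z|) => _ [T /= T0 <-].
  have := eS T T0; have := pm_tri eP z 0 (T *: v).
  have := pm_tri eP (z + T *: v) z (T *: v); rewrite /h.
  have := pm_lip eP (z + T *: v) (T *: v); rewrite addrK.
  have := pm_lip eP 0 z; rewrite sub0r normrN; lra.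
apply: ler_eps => eps eps0; rewrite -lerBlDr.
apply: (cvgr_to_ge (ed z (z + t *: v))).
have [_ [T /= T0 <-] hT] := sup_adherent eps0 hs.
have : \forall j \near U, T <= (j%:R : R).
  by apply: Uoo; exact: nbhs_infty_ger.
apply: filterS => j Tj; rewrite /translate.
have j0 : 0 <= (j%:R : R) by [].
have hj : h (j%:R + t) <= sup (h @` [set T | 0 <= T]).
  by apply: sup_upper_bound => //; exists (j%:R + t) => //=; rewrite addr_ge0.
have h1 : e z (z + j%:R *: v) <= e z (z + T *: v) + (j%:R - T) * S.
  apply: le_trans (pm_tri eP (z + T *: v) _ _) _; rewrite lerD2l.
  have -> : z + j%:R *: v = z + T *: v + (j%:R - T) *: v.
    by rewrite -addrA -scalerDl [T + _]addrC subrK.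
  by apply: le_max_speed => //; rewrite subr_ge0.
have := pm_tri eP (z + j%:R *: v) z (z + (j%:R + t) *: v).
rewrite [z + t *: v + _]addrAC -[z + _ + _]addrA -scalerDl.
by move: hj hT; rewrite /h; lra.
Qed.

Lemma constant_speed_tangent_class : tangent_class (K `&` constant_speed v S).
Proof.
split.
- by move=> d [/(tc_pm KP)].
- move=> a d [Kd dS]; split; first exact: tc_translate.
  by move=> x t t0; rewrite /translate addrAC dS.
- move=> s d s0 [Kd dS]; split; first exact: tc_dilate.
  move=> x t t0; rewrite /dilate scalerDr scalerA dS ?mulr_ge0 ?invr_ge0 ?(ltW s0) //.
  by rewrite mulrA mulrA divff ?mul1r // gt_eqF.
- move=> d_ d pmj Kj dP dd; split.
    by refine (tc_ulim KP pmj _ dP dd); apply: filterS Kj => j [].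
  move=> x t t0; apply/eqP; rewrite eq_le; apply/andP; split.
    by apply: (cvgr_to_le (dd _ _)); apply: filterS Kj => j [_ /(_ x t t0) ->].
  by apply: (cvgr_to_ge (dd _ _)); apply: filterS Kj => j [_ /(_ x t t0) ->].
Qed.
End Step.

Section Directions.
Variables (K : set (V -> V -> R)).
Hypotheses (KP : tangent_class K) (K0 : K !=set0).

Fixpoint speed_class (v_ : nat -> V) (i : nat) : set (V -> V -> R) :=
  if i is i'.+1 then
    speed_class v_ i' `&` constant_speed (v_ i') (max_speed (speed_class v_ i') (v_ i'))
  else K.

(** The directions are treated one after the other, each within the class left by the previous ones;
    the limit of a diagonal sequence lies in all these classes. *)
Lemma constant_speeds (v_ : nat -> V) :
  exists2 d, K d & forall i, exists S, constant_speed (v_ i) S d.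
Proof.
have H i : tangent_class (speed_class v_ i) /\ speed_class v_ i !=set0.
  elim: i => //= i [IH1 IH2]; split; first exact: constant_speed_tangent_class.
  exact: constant_speed_nonempty.
have sub i j : (i <= j)%N -> speed_class v_ j `<=` speed_class v_ i.
  elim: j => [|j IH]; first by rewrite leqn0 => /eqP ->.
  by rewrite leq_eqVlt => /predU1P[->//|/IH ij] d /= [/ij].
have [d_ Kd] := choice (fun i => (H i).2).
have pmj j := tc_pm (H j).1 (Kd j).
have [d dP dd] := pmetric_ulim UU pmj.
have Kdi i : speed_class v_ i d.
  refine (tc_ulim (H i).1 pmj _ dP dd); apply: Uoo; near=> j; apply: (sub i j) (Kd j).
  by near: j; exact: nbhs_infty_ge.
exists d; first exact: (Kdi 0%N).
by move=> i; have [_ ?] := Kdi i.+1; eexists; eassumption.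
Unshelve. all: by end_near.
Qed.

(** Constant speed in all integer directions suffices: by the Lipschitz bound, the distance from [x]
    to [x + t *: w] is then linear in [t] and independent of [x], up to arbitrarily small relative
    errors, for every [w]. *)
Lemma seminorm_in_class : exists d, [/\ K d,
  forall a x y, d (x + a) (y + a) = d x y &
  forall t x, 0 <= t -> d 0 (t *: x) = t * d 0 x].
Proof.
(* An enumeration of the integer vectors; numbers that code none give the vector 0. *)
pose v_ i : V := map_mx (fun z : int => z%:~R) (odflt 0 (choice.unpickle i : option 'rV[int]_D)).
have [d Kd dv] := constant_speeds v_; have dP := tc_pm KP Kd.
have approx (w : V) (eps : R) : 0 < eps ->
    exists S, forall x t, 0 <= t -> `|d x (x + t *: w) - t * S| <= t * eps.
  (* Rounding down the coordinates of [q%:R *: w] gives an integer vector within distance 1; after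
     division by [q] the Lipschitz bound costs at most [eps] per unit of [t]. *)
  move=> eps0; pose q := (Num.truncn ((`|C| + 1) / eps)).+1.
  have q0 : 0 < (q%:R : R) by rewrite ltr0n.
  have qe : `|C| / q%:R <= eps.
    rewrite ler_pdivrMr // mulrC -ler_pdivrMr //.
    apply: le_trans (ltW (truncnS_gt _)); rewrite ler_pM2r ?invr_gt0 //.
    by rewrite lerDl.
  pose z : 'rV[int]_D := \row_i Num.floor (q%:R * w 0 i).
  have [S Sz] : exists S, constant_speed (map_mx (fun a : int => a%:~R) z) S d.
    by have [S SP] := dv (choice.pickle z); exists S; move: SP; rewrite /v_ choice.pickleK.
  exists (S / q%:R) => x t t0; set zr := map_mx _ z in Sz.
  have tq0 : 0 <= t / q%:R by rewrite divr_ge0.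
  have -> : t * (S / q%:R) = d x (x + (t / q%:R) *: zr).
    by rewrite Sz // mulrA mulrAC.
  apply: le_trans (pm_quad dP _ _ _ _) _; rewrite (pm_xx dP) add0r.
  apply: le_trans (pm_lip dP _ _) _.
  rewrite opprD addrACA subrr add0r.
  have -> : t *: w - (t / q%:R) *: zr = (t / q%:R) *: (q%:R *: w - zr).
    by rewrite scalerBr scalerA divfK // gt_eqF.
  rewrite normrZ ger0_norm //.
  have n1 : `|q%:R *: w - zr| <= 1.
    apply: norm_le => // i; rewrite !mxE.
    have := floor_itv (q%:R * w 0 i); rewrite intrD ler_norml => /andP[]; lra.
  apply: le_trans (_ : `|C| * (t / q%:R * 1) <= _).
    apply: le_trans (_ : `|C| * (t / q%:R * `|q%:R *: w - zr|) <= _).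
      by rewrite ler_wpM2r ?ler_norm // mulr_ge0.
    by rewrite ler_wpM2l // ler_wpM2l.
  by rewrite mulr1 mulrCA ler_wpM2l.
have tr x y w : d x (x + w) = d y (y + w).
  apply/eqP; rewrite -subr_eq0 -normr_le0; apply: ler_eps => eps eps0.
  have [S SP] := approx w _ (divr_gt0 eps0 (ltr0Sn _ 1)).
  have := SP x 1 ler01; have := SP y 1 ler01.
  by rewrite !scale1r !mul1r !ler_norml; lra.
exists d; split=> // [a x y|t x t0].
  rewrite (_ : y + a = x + a + (y - x)); last by rewrite addrAC [x + _]addrC subrK.
  by rewrite -(tr x) [x + _]addrC subrK.
apply/eqP; rewrite -subr_eq0 -normr_le0; apply: ler_eps => eps eps0; rewrite add0r.
have t1 : 0 < t + 1 by rewrite ltr_wpDl.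
have e0 : 0 < eps / (t + 1) / 2 by rewrite !divr_gt0.
have [S SP] := approx x _ e0; move: e0 SP; set e := eps / _ / 2 => e0 SP.
have := SP 0 1 ler01; have := SP 0 t t0.
rewrite !scale1r !mul1r !add0r => H1 H2.
have -> : d 0 (t *: x) - t * d 0 x = (d 0 (t *: x) - t * S) - t * (d 0 x - S) by ring.
apply: le_trans (ler_normB _ _) _; rewrite normrM (ger0_norm t0).
apply: le_trans (lerD H1 (ler_wpM2l t0 H2)) _.
rewrite (_ : eps = (t + 1) * e + (t + 1) * e); last first.
  by rewrite /e; field; rewrite gt_eqF.
by rewrite lerD // ler_wpM2r // ?ltW // ltrDl.
Qed.
End Directions.
End Seminorm.

(** * Seminorms without separating boxes *)

Lemma thin_finType (R : realType) (D n : nat) (T : finType) (d : 'rV[R]_D -> 'rV[R]_D -> R)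
    (A : set 'rV[R]_D) (F : T -> set 'rV[R]_D) (r : T -> R) (t : R) :
  (forall i, 0 <= r i) -> A `<=` \bigcup_i F i ->
  (forall i x y, A x -> A y -> F i x -> F i y -> d x y <= r i) ->
  \sum_i r i ^+ n < t -> thin n d A t.
Proof.
move=> r0 AF Fr rt; exists #|T|, (F \o enum_val), (r \o enum_val); split=> //=.
- by move=> x /AF[i _ Fx]; exists (enum_rank i) => //=; rewrite enum_rankK.
- by move=> i x y; exact: Fr.
- rewrite (reindex enum_rank) /=; last exact: onW_bij (@enum_rank_bij T).
  by under eq_bigr do rewrite enum_rankK.
Qed.

Section KernelOfSeminorm.
Variables (R : realType) (D n : nat) (C : R).
Notation V := 'rV[R]_D.
Variable d : V -> V -> R.
Hypotheses (dP : pmetric C d) (dT : forall a x y, d (x + a) (y + a) = d x y).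
Hypothesis dZ : forall t x, 0 <= t -> d 0 (t *: x) = t * d 0 x.
Hypothesis dN : nonseparated n setT d.
Let N x := d 0 x.

Lemma seminormE x y : d x y = N (y - x).
Proof. by rewrite -(dT (- x)) subrr. Qed.

Lemma seminorm_ge0 x : 0 <= N x. Proof. exact: pm_ge0 dP _ _. Qed.

Lemma seminormD x y : N (x + y) <= N x + N y.
Proof. by apply: le_trans (pm_tri dP x _ _) _; rewrite (seminormE x) [x + y]addrC addrK. Qed.

Lemma seminormN x : N (- x) = N x.
Proof. by rewrite /N (pm_sym dP) seminormE sub0r opprK. Qed.

Lemma seminormZ t x : N (t *: x) = `|t| * N x.
Proof.
have [t0|t0] := leP 0 t; first by rewrite ger0_norm //; exact: dZ.
by rewrite ltr0_norm // -seminormN -scaleNr /N dZ // oppr_ge0 ltW.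
Qed.

Lemma seminorm_le x : N x <= C * `|x|.
Proof. by apply: le_trans (pm_lip dP _ _) _; rewrite sub0r normrN. Qed.

Lemma seminorm_sum (J : finType) (F : J -> V) : N (\sum_i F i) <= \sum_i N (F i).
Proof.
elim/big_ind2 : _ => [|x a y b xa yb|//]; first by rewrite /N (pm_xx dP).
exact: le_trans (seminormD _ _) (lerD xa yb).
Qed.

Definition supported (I : {set 'I_D}) (x : V) := forall i, i \notin I -> x 0 i = 0.

Definition definite (I : {set 'I_D}) := forall x, supported I x -> N x = 0 -> x = 0.

Lemma seminorm_continuous : continuous N.
Proof.
move=> x; apply: (iffRL (@cvgrPdist_le _ _ _ _ (nbhs_filter x) _ _)) => eps eps0.
have C1 : 0 < `|C| + 1 by rewrite ltr_wpDl.
apply/nbhs_ballP; exists (eps / (`|C| + 1)) => /=; first by rewrite divr_gt0.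
move=> y; rewrite -ball_normE /= => xy.
rewrite /N; apply: le_trans (pm_quad dP _ _ _ _) _; rewrite (pm_xx dP) add0r.
apply: le_trans (pm_lip dP _ _) _.
apply: le_trans (_ : (`|C| + 1) * `|x - y| <= _).
  by rewrite ler_wpM2r // (le_trans (ler_norm _)) // lerDl.
by rewrite mulrC -ler_pdivlMr // ltW.
Qed.

(** The constant is the minimum of [N] on the compact unit sphere of the coordinate subspace. *)
Lemma definite_bound I : definite I ->
  exists2 c, 0 < c & forall x, supported I x -> c * `|x| <= N x.
Proof.
move=> dI; pose S := [set x | supported I x /\ `|x| = 1].
have cS : compact S.
  apply: bounded_closed_compact.
    exists 1; split; first exact: num_real.
    by move=> M M1 x [_ x1]; suff : `|x| <= M by []; rewrite x1 ltW.
  have -> : S = (\bigcap_(i in [set i | i \notin I]) (fun x : V => x 0 i) @^-1` [set 0])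
      `&` Num.norm @^-1` [set 1].
    by apply/seteqP; split=> x [].
  apply: closedI.
    apply: closed_bigI => i _; apply: closed_comp => [x _|]; last exact: closed_eq.
    exact: coord_continuous.
  apply: closed_comp => [x _|]; last exact: closed_eq.
  exact: norm_continuous.
have [S0|/set0P[x0 Sx0]] := eqVneq S set0.
  exists 1 => // x sx; have [->|x0] := eqVneq x 0; first by rewrite normr0 mulr0 seminorm_ge0.
  suff : S (`|x|^-1 *: x) by rewrite S0.
  split=> [i iI|]; first by rewrite mxE sx ?mulr0.
  by rewrite normrZ normfV normr_id mulVf // normr_eq0.
have [c] := compact_EVT_min (ex_intro _ x0 Sx0) cS
  (continuous_subspaceT seminorm_continuous).
rewrite inE => -[sc c1] cmin; exists (N c).
  rewrite lt_neqAle seminorm_ge0 andbT eq_sym; apply: contra_eqN c1 => /eqP.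
  by move=> /(dI _ sc) ->; rewrite normr0 eq_sym oner_eq0.
move=> x sx; have [->|x0'] := eqVneq x 0; first by rewrite normr0 mulr0 seminorm_ge0.
have xn : 0 < `|x| by rewrite normr_gt0.
have : N c <= N (`|x|^-1 *: x).
  apply: cmin; rewrite inE; split=> [i iI|]; first by rewrite mxE sx ?mulr0.
  by rewrite normrZ normfV normr_id mulVf // normr_eq0.
by rewrite seminormZ normfV normr_id mulrC ler_pdivlMr.
Qed.

(** Otherwise a box with side 1 along [I] and a small side [tau] in the other directions is
    separating. The difference of two points on opposite faces is within [tau] of a vector supported
    in [I] of norm at least 1, and [tau] is chosen so that this costs at most half of [c]. *)
Lemma definite_card I : definite I -> #|I| <> n.
Proof.
move=> dI In; have [c c0 cN] := definite_bound dI.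
have C1 : 0 < `|C| + 1 by rewrite ltr_wpDl.
pose tau := c / (`|C| + 1) / 2; have tau0 : 0 < tau by rewrite !divr_gt0.
pose l : V := \row_i if i \in I then 1 else tau.
have c2 : 0 < c / 2 by rewrite divr_gt0.
apply: (dN (p := 0) (l := l)) In c2 _ _ => // [i|k kI x y bx by_ xk yk].
  by rewrite mxE; case: ifP.
pose w : V := \row_i if i \in I then (y - x) 0 i else 0.
have sw : supported I w by move=> i iI; rewrite mxE (negPf iI).
have bw i : `|(y - x) 0 i| <= l 0 i.
  have := bx i; have := by_ i; rewrite !mxE ler_norml.
  by case: ifP => _ /andP[? ?] /andP[? ?]; lra.
have w1 : 1 <= `|w|.
  apply: le_trans (le_coord _ k); rewrite mxE kI !mxE xk yk !mxE kI.
  by rewrite add0r subr0 normr1.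
have wt : `|w - (y - x)| <= tau.
  apply: norm_le => [|i]; first exact: ltW.
  have := bw i; rewrite !mxE; case: ifP => _; rewrite ?subrr ?normr0 ?(ltW tau0) //.
  by rewrite sub0r normrN.
have := cN w sw; have := seminormD (w - (y - x)) (y - x); rewrite subrK.
have := seminorm_le (w - (y - x)); rewrite seminormE.
have : C * `|w - (y - x)| <= c / 2.
  apply: le_trans (_ : (`|C| + 1) * tau <= _); last first.
    by rewrite /tau le_eqVlt; apply/orP; left; apply/eqP; field; rewrite gt_eqF.
  apply: le_trans (_ : (`|C| + 1) * `|w - (y - x)| <= _); last by rewrite ler_pM2l.
  by rewrite ler_wpM2r // (le_trans (ler_norm _)) // lerDl.
have : c <= c * `|w| by rewrite ler_pMr.
lra.
Qed.

Lemma definite_lt_card I : definite I -> (#|I| < n)%N.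
Proof.
move=> dI; rewrite ltnNge; apply/negP => nI.
have sJ : [set i in take n (enum I)] \subset I.
  by apply/fintype.subsetP => i; rewrite inE => /mem_take; rewrite mem_enum.
apply: (@definite_card [set i in take n (enum I)]).
  move=> x sx; apply: dI => i iI; apply: sx; apply: contra iI; exact: (fintype.subsetP sJ).
rewrite cardsE; have /card_uniqP -> := take_uniq n (enum_uniq I).
by rewrite size_takel // -cardE.
Qed.

(** Take [I] maximal among the definite sets. For [j] outside [I], maximality gives a kernel vector
    with coordinate 1 at [j] and 0 at the other indices outside [I]. Subtracting multiples of these
    vectors clears all coordinates outside [I] without affecting the seminorm. *)
Lemma kernel_projection : exists (I : {set 'I_D}) (P : V -> V) (M : R),
  [/\ (#|I| < n)%N, 1 <= M, (forall x y, P (y - x) = P y - P x)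
    & [/\ forall x, supported I (P x), forall x, N x <= N (P x)
        & forall x, `|P x| <= M * `|x|]].
Proof.
have [I /maxsetP[/asboolP dI maxI] _] :
    {I : {set 'I_D} | maxset (fun J => `[<definite J>]) I & finset.set0 \subset I}.
  apply: maxset_exists; apply/asboolP => x sx _.
  by apply/rowP => i; rewrite mxE sx // inE.
have H j : exists u : V, j \notin I ->
    [/\ u 0 j = 1, N u = 0 & forall i, i \notin I -> i != j -> u 0 i = 0].
  have [jI|jI] := boolP (j \in I); first by exists 0.
  have : ~ definite (j |: I).
    move=> dJ; have := maxI _ (introT (asboolP _) dJ) (finset.subsetU1 _ _).
    by move=> E; move: jI; rewrite -E finset.setU11.
  move=> /existsNP[v /not_implyP[sv /not_implyP[Nv v0]]].
  have vj : v 0 j != 0.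
    apply: contra_notN v0 => /eqP vj; apply: dI Nv => i iI.
    have [->//|ij] := eqVneq i j; apply: sv.
    by rewrite !inE negb_or ij.
  exists ((v 0 j)^-1 *: v) => _; split=> [||i iI ij].
  - by rewrite mxE mulVf.
  - by rewrite seminormZ Nv mulr0.
  - by rewrite mxE (sv i) ?mulr0 //; rewrite !inE negb_or ij.
have [u_ uP] := choice H; pose u j : V := if j \in I then 0 else u_ j.
have Nu j : N (u j) = 0.
  by rewrite /u; case: ifPn => [_|/uP[]//]; rewrite /N (pm_xx dP).
pose P (x : V) : V := x - \sum_j x 0 j *: u j.
exists I, P, (1 + \sum_j `|u j|); split.
- exact: definite_lt_card.
- by rewrite lerDl sumr_ge0.
- move=> x y; rewrite /P.
  have -> : \sum_j (y - x) 0 j *: u j = \sum_j y 0 j *: u j - \sum_j x 0 j *: u j.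
    by rewrite -sumrB; apply: eq_bigr => j _; rewrite !mxE scalerBl.
  by rewrite !opprB addrACA [RHS]addrACA [- x - _]addrC.
split=> [x i iI|x|x].
- rewrite /P !mxE summxE (bigD1 i) //= big1 ?addr0 => [|j ji].
    by rewrite /u (negPf iI) mxE; have [-> _ _] := uP _ iI; rewrite mulr1 subrr.
  rewrite mxE /u; case: ifPn => [_|/uP[_ _ ->]//]; rewrite ?mulr0 //.
    by rewrite mxE mulr0.
  by rewrite eq_sym.
- rewrite -{1}(subrK (\sum_j x 0 j *: u j) x) -/(P x).
  apply: le_trans (seminormD _ _) _; rewrite gerDl.
  apply: le_trans (seminorm_sum _) _; rewrite big1 // => j _.
  by rewrite seminormZ Nu mulr0.
- apply: le_trans (ler_normB _ _) _; rewrite mulrDl mul1r lerD2l mulr_suml.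
  apply: le_trans (ler_norm_sum _ _ _) _; apply: ler_sum => j _.
  by rewrite normrZ mulrC ler_wpM2l // le_coord.
Qed.

(** Cut the image of [P] into K ^ #|I| cells of side [h]. Each has diameter at most B / K, and the
    sum of the n-th powers is at most B ^ n / K because #|I| < n. *)
Lemma thin_cube p r eps : 0 < r -> 0 < eps -> thin n d (cube p r) eps.
Proof.
move=> r0 eps0.
have [I [P [M [In M1 PB [sP NP PM]]]]] := kernel_projection.
have M0 : 0 < M by rewrite (lt_le_trans ltr01).
pose B := (`|C| + 1) * (2 * M * r).
have B0 : 0 < B by rewrite !mulr_gt0 // ltr_wpDl.
have [k KB] : exists k : nat, B ^+ n / k.+1%:R < eps.
  exists (Num.truncn (B ^+ n / eps)).
  by rewrite ltr_pdivrMr ?ltr0n // mulrC -ltr_pdivrMr //; exact: truncnS_gt.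
pose K := k.+1; have K0 : 0 < (K%:R : R) by rewrite ltr0n.
pose h := 2 * M * r / K%:R.
have h0 : 0 < h by rewrite divr_gt0 // !mulr_gt0.
pose G := {ffun {i | i \in I} -> 'I_K}.
pose F (g : G) := [set x : V | forall i (iI : i \in I),
  (g (exist _ i iI))%:R * h <= P (x - p) 0 i + M * r <= (g (exist _ i iI)).+1%:R * h].
apply: (@thin_finType R D n G d _ F (fun=> B / K%:R)).
- by move=> _; rewrite divr_ge0 ?ltW.
- move=> x cx.
  have xp : `|x - p| <= r.
    apply: norm_le => [|i]; first exact: ltW.
    by have := cx i; rewrite !mxE ler_norml => /andP[? ?]; lra.
  have xi i : 0 <= P (x - p) 0 i + M * r <= K%:R * h.
    have -> : K%:R * h = 2 * (M * r) by rewrite /h; field; rewrite gt_eqF.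
    have := le_trans (le_coord (P (x - p)) i) (PM _).
    have := ler_wpM2l (ltW M0) xp.
    by rewrite ler_norml => ? /andP[? ?]; lra.
  (* The cap at [k] puts the endpoint K h into the last cell. *)
  exists [ffun i => inord (minn (Num.truncn ((P (x - p) 0 (val i) + M * r) / h)) k)] => //.
  move=> i iI; rewrite ffunE inordK ?ltnS ?geq_minr //=.
  have /andP[x0 xK] := xi i; set y := P (x - p) 0 i + M * r in x0 xK *.
  have yh0 : 0 <= y / h by rewrite divr_ge0 // ltW.
  have /andP[t1 t2] := truncn_itv yh0.
  apply/andP; split.
    by rewrite -ler_pdivlMr //; apply: le_trans t1; rewrite ler_nat geq_minl.
  rewrite -ler_pdivrMr // /minn; case: ifP => _; first exact: ltW.
  by rewrite ler_pdivrMr.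
- move=> g x y _ _ gx gy.
  rewrite seminormE; apply: le_trans (NP _) _; apply: le_trans (seminorm_le _) _.
  have -> : B / K%:R = (`|C| + 1) * h by rewrite /B /h !mulrA.
  apply: le_trans (_ : (`|C| + 1) * `|P (y - x)| <= _).
    by rewrite ler_wpM2r // (le_trans (ler_norm _)) // lerDl.
  rewrite ler_wpM2l ?addr_ge0 //; apply: norm_le => [|i]; first exact: ltW.
  have [iI|iI] := boolP (i \in I); last by rewrite sP // normr0 ltW.
  rewrite (_ : y - x = (y - p) - (x - p)); last by rewrite opprB addrA subrK.
  rewrite PB !mxE.
  have := gx i iI; have := gy i iI; rewrite -natr1 mulrDl mul1r ler_norml.
  by move=> /andP[? ?] /andP[? ?]; lra.
- rewrite sumr_const card_ffun card_ord card_sig.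
  have -> : #|[pred i | i \in I]| = #|I| by apply: eq_card.
  apply: le_lt_trans KB; rewrite -[leLHS]mulr_natr expr_div_n -mulrA ler_wpM2l ?exprn_ge0 ?(ltW B0) //.
  rewrite natrX ler_pdivrMl ?exprn_gt0 // ler_pdivlMr // -exprSr.
  by rewrite ler_weXn2l // ler1n.
Qed.

End KernelOfSeminorm.

(** * Blow-up *)

Section BlowUp.
Variables (R : realType) (D n : nat).
Notation V := 'rV[R]_D.
Implicit Types (d e : V -> V -> R) (p l x y z a q : V) (I : {set 'I_D}).

Lemma box_translate a p l x : box (p + a) l x <-> box p l (x - a).
Proof.
by split=> H i; have := H i; rewrite !mxE => /andP[? ?]; apply/andP; split; lra.
Qed.

Lemma box_dilate (s : R) p l x : 0 < s ->
  box (s^-1 *: p) (s^-1 *: l) x <-> box p l (s *: x).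
Proof.
move=> s0; split=> H i; have := H i; rewrite !mxE -mulrDr.
  by rewrite ler_pdivrMl // ler_pdivlMl.
by rewrite ler_pdivrMl // ler_pdivlMl.
Qed.

Lemma cube_dilate (s : R) p (r : R) x : 0 < s ->
  cube (s^-1 *: p) (r / s) x <-> cube p r (s *: x).
Proof.
move=> s0; rewrite /cube (_ : const_mx (r / s) = s^-1 *: const_mx r).
  exact: box_dilate.
by apply/rowP => i; rewrite !mxE mulrC.
Qed.

Lemma separating_translate a d p l I c :
  separating (translate a d) p l I c -> separating d (p + a) l I c.
Proof.
move=> H k kI x y /box_translate bx /box_translate by_ xk yk.
have := H k kI _ _ bx by_; rewrite /translate !subrK; apply.
  by rewrite !mxE xk !mxE addrK.
by rewrite !mxE yk !mxE addrAC addrK.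
Qed.

Lemma separating_dilate (s : R) d p l I c : 0 < s ->
  separating (dilate s d) p l I c -> separating d (s^-1 *: p) (s^-1 *: l) I (c / s).
Proof.
move=> s0 H k kI x y; have sn : s != 0 by rewrite gt_eqF.
rewrite !box_dilate // => bx by_ xk yk.
have := H k kI _ _ bx by_; rewrite /dilate !scalerA mulVf // !scale1r.
rewrite ler_pdivrMr // mulrC; apply; first by rewrite !mxE xk !mxE mulVKf.
by rewrite !mxE yk !mxE mulrDr !mulVKf.
Qed.

Lemma thin_translate a d p r t :
  thin n (translate a d) (cube p r) t -> thin n d (cube (p + a) r) t.
Proof.
move=> [N [F [w [w0 AF Fw wt]]]].
exists N, (fun i => [set x | F i (x - a)]), w; split=> //.
  by move=> x /box_translate /AF.
move=> i x y /box_translate cx /box_translate cy Fx Fy.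
by have := Fw i _ _ cx cy Fx Fy; rewrite /translate !subrK.
Qed.

Lemma thin_dilate (s : R) d p r t : 0 < s ->
  thin n (dilate s d) (cube p r) t -> thin n d (cube (s^-1 *: p) (r / s)) (t / s ^+ n).
Proof.
move=> s0 [N [F [w [w0 AF Fw wt]]]]; have sn : s != 0 by rewrite gt_eqF.
exists N, (fun i => [set x | F i (s *: x)]), (fun i => w i / s); split=> //.
- by move=> i; rewrite divr_ge0 // ltW.
- by move=> x /(cube_dilate _ _ _ s0) /AF.
- move=> i x y /(cube_dilate _ _ _ s0) cx /(cube_dilate _ _ _ s0) cy Fx Fy.
  have := Fw i _ _ cx cy Fx Fy; rewrite /dilate !scalerA mulVf // !scale1r.
  by rewrite ler_pdivlMr // mulrC.
- under eq_bigr do rewrite expr_div_n.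
  by rewrite -mulr_suml ltr_pM2r // invr_gt0 exprn_gt0.
Qed.

Lemma ultrafilter_infty : exists2 U : set_system nat, UltraFilter U & \oo `<=` U.
Proof. by have [U [? ?]] := ultraFilterLemma (@eventually_filter); exists U. Qed.

Variable C : R.

Section ThickClass.
Variables (U : set_system nat) (UU : UltraFilter U) (eps : R).

Definition thick_nonseparated : set (V -> V -> R) := [set d | [/\ pmetric C d,
  nonseparated n setT d & forall p r, 0 < r -> ~ thin n d (cube p r) (eps * r ^+ n)]].

Lemma thick_tangent_class : tangent_class C U thick_nonseparated.
Proof.
split.
- by move=> d [].
- move=> a d [dP dN dT]; split; first exact: pmetric_translate.
    move=> p l I c l0 In c0 _ /separating_translate; exact: dN.
  by move=> p r r0 /thin_translate; exact: dT.
- move=> s d s0 [dP dN dT]; split; first exact: pmetric_dilate.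
    move=> p l I c l0 In c0 _ /(separating_dilate s0); apply: dN => // [i|].
      by rewrite mxE mulr_gt0 // invr_gt0.
    by rewrite divr_gt0.
  move=> p r r0 /(thin_dilate s0); rewrite -mulrA -expr_div_n; apply: dT.
  by rewrite divr_gt0.
- move=> d_ d pmj Kj dP dd; split=> //.
    by apply: (nonseparated_ulim UU pmj dP dd); apply: filterS Kj => j [].
  move=> p r r0 /(thin_ulim UU pmj dP dd (@subset_refl _ _)) Tj.
  by have [j [[_ _ H]]] := filter_ex (filterI Kj Tj); apply: H.
Qed.
End ThickClass.

(** A nonempty class would contain a seminorm, whose unit cube is thin by [thin_cube]. *)
Lemma no_thick_nonseparated eps : 0 < eps -> ~ (thick_nonseparated eps !=set0).
Proof.
move=> eps0 K0; have [U UU Uoo] := ultrafilter_infty.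
have [d [[dP dN dT] tr hom]] := seminorm_in_class UU Uoo (thick_tangent_class UU eps) K0.
apply: (dT 0 1) => //; rewrite expr1n mulr1; exact: thin_cube dP tr hom dN _ _ _ _ _.
Qed.

(** Counterexamples for ratios tending to 0, recentred and rescaled so that their cubes exhaust the
    space, have an ultralimit that is nonseparated everywhere and thick at all places and scales.
    Hence [rho] depends on neither [d] nor the cube. *)
Lemma thin_subcube eps : 0 < eps -> exists2 rho, 0 < rho &
  forall d p s, pmetric C d -> nonseparated n (unit_cube R D) d -> 0 < s ->
    cube p s `<=` unit_cube R D ->
    exists q r, [/\ rho * s <= r, r <= s, cube q r `<=` cube p s & thin n d (cube q r) (eps * r ^+ n)].
Proof.
move=> eps0; apply: contrapT => H.
have {}H j : exists dps : (V -> V -> R) * V * R, [/\ pmetric C dps.1.1,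
    nonseparated n (unit_cube R D) dps.1.1, 0 < dps.2,
    cube dps.1.2 dps.2 `<=` unit_cube R D &
    forall q r, j.+1%:R ^- 2 * dps.2 <= r -> r <= dps.2 -> cube q r `<=` cube dps.1.2 dps.2 ->
      ~ thin n dps.1.1 (cube q r) (eps * r ^+ n)].
  apply: contrapT => Hj; apply: H; exists (j.+1%:R ^- 2).
    by rewrite invr_gt0 exprn_gt0.
  move=> d p s dP dN s0 ps; apply: contrapT => Hq; apply: Hj.
  exists (d, p, s); split=> //= q r sr rs qr tq; apply: Hq; by exists q, r.
have [dps dpsP] := choice H.
pose d_ j := (dps j).1.1; pose p_ j := (dps j).1.2; pose s_ j := (dps j).2.
have dP j : pmetric C (d_ j) by case: (dpsP j).
have s0 j : 0 < s_ j by case: (dpsP j).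
pose c_ j : V := p_ j + const_mx (s_ j / 2).
(* After rescaling by [L j] the cube has side [j + 1], and the subcubes that are
   not thin include all those of side between [1 / (j + 1)] and [j + 1]. *)
pose L j : R := j.+1%:R / s_ j.
have L0 j : 0 < L j by rewrite divr_gt0.
pose e_ j := dilate (L j) (translate (c_ j) (d_ j)).
have eP j : pmetric C (e_ j) by apply: pmetric_dilate => //; exact: pmetric_translate.
have [U UU Uoo] := ultrafilter_infty.
have [e eP' ee] := pmetric_ulim UU eP.
(* The rescaled cubes are centred at 0 with side j + 1, so they eventually contain any given box. *)
have inside p l : \forall j \near U,
    box ((L j)^-1 *: p + c_ j) ((L j)^-1 *: l) `<=` cube (p_ j) (s_ j).
  have : \forall j \near U, 2 * (`|p| + `|l|) <= (j%:R : R).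
    by apply: Uoo; exact: nbhs_infty_ger.
  apply: filterS => j jB x bx i.
  have := bx i; have := le_coord p i; have := le_coord l i.
  have E : (L j)^-1 = s_ j / j.+1%:R by rewrite /L invf_div.
  have j1 : 2 * (`|p| + `|l|) <= (j.+1%:R : R) by rewrite -natr1; lra.
  have B u : `|u| <= `|p| + `|l| -> - (s_ j / 2) <= (L j)^-1 * u <= s_ j / 2.
    move=> uB; have q0 : 0 <= s_ j / j.+1%:R by rewrite divr_ge0 // ltW.
    rewrite -ler_norml normrM E ger0_norm //.
    rewrite mulrAC ler_pdivrMr // -mulrA ler_pM2l // mulrC ler_pdivlMr //; lra.
  rewrite !mxE -/(p_ j) -/(s_ j) => lpi lli /andP[x1 x2].
  have := B (p 0 i); have := B (p 0 i + l 0 i).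
  have pl : `|p 0 i + l 0 i| <= `|p| + `|l|.
    by apply: le_trans (ler_normD _ _) _; lra.
  have pi : `|p 0 i| <= `|p| + `|l| by apply: le_trans lli _; rewrite lerDl.
  move=> /(_ pl); rewrite mulrDr => /andP[? ?] /(_ pi) /andP[? ?].
  by move: x1 x2 => ? ?; apply/andP; split; lra.
apply: (@no_thick_nonseparated eps eps0); exists e; split=> //.
  move=> p l I c l0 In c0 _ /(separating_ulim UU eP eP' ee c0) Sj.
  have [j [Sepj ins]] := filter_ex (filterI Sj (inside p l)).
  have := separating_translate (separating_dilate (L0 j) Sepj).
  have [_ dN _ cu _] := dpsP j; apply: dN => // [i||x bx].
  - by rewrite mxE mulr_gt0 // invr_gt0.
  - by rewrite divr_gt0 // divr_gt0.
  - by apply: cu; exact: ins.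
move=> p r r0 /(thin_ulim UU eP eP' ee (@subset_refl _ _)) Tj.
have rj : \forall j \near U, r^-1 + r <= (j%:R : R) by apply: Uoo; exact: nbhs_infty_ger.
have [j [[Thj ins] rj']] := filter_ex (filterI (filterI Tj (inside p (const_mx r))) rj).
have ri0 : 0 < r^-1 by rewrite invr_gt0.
have [_ _ _ _] := dpsP j; apply.
4: have := thin_translate (thin_dilate (L0 j) Thj).
4: by rewrite -mulrA -expr_div_n; apply.
- rewrite -/(s_ j) /L invf_div mulrCA [leLHS]mulrC ler_pM2l //.
  rewrite expr2 invfM ler_pM2r ?invr_gt0 //.
  rewrite invf_ple ?posrE // -natr1; lra.
- rewrite -/(s_ j) /L invf_div mulrCA ler_piMr ?(ltW (s0 j)) //.
  by rewrite ler_pdivrMr // mul1r -natr1; lra.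
- move=> x cx; apply: ins; move: cx.
  rewrite /cube (_ : const_mx _ = (L j)^-1 *: const_mx r) //.
  by apply/rowP => i; rewrite !mxE mulrC.
Qed.
End BlowUp.

(** * Dyadic subdivisions *)

Section Dyadic.
Variables (R : realType) (D : nat).
Notation V := 'rV[R]_D.
Implicit Types (q : dyadic_index D).

Definition child q (N : nat) (i : {ffun 'I_D -> 'I_(2 ^ N)}) : dyadic_index D :=
  ((q.1 + N)%N, \row_l (q.2 0 l * (2 ^ N)%N%:Z + (i l : nat)%:Z)).

Definition corner q : V := \row_i ((q.2 0 i)%:~R * side R q).

Lemma cubeP (p x : V) (r : R) :
  cube p r x <-> forall i, p 0 i <= x 0 i <= p 0 i + r.
Proof. by split=> H i; have := H i; rewrite [const_mx r 0 i]mxE. Qed.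

Lemma side_gt0 q : 0 < side R q. Proof. by rewrite invr_gt0 exprn_gt0. Qed.

Lemma side_le1 q : side R q <= 1.
Proof. by rewrite invf_le1 ?exprn_gt0 // exprn_ege1 // ler1n. Qed.

Lemma dyadic_cubeE q : dyadic_cube R q = cube (corner q) (side R q).
Proof.
by apply/seteqP; split=> x H i; have := H i;
  rewrite !mxE intrD mulrDl mul1r.
Qed.

Lemma side_child q N i : side R (@child q N i) = side R q / (2 ^ N)%:R.
Proof. by rewrite /side /= exprD invfM natrX. Qed.

Lemma corner_child q N i l :
  corner (@child q N i) 0 l = corner q 0 l + (i l)%:R * side R (@child q N i).
Proof.
rewrite !mxE intrD intrM mulrDl; congr (_ + _ * _).
rewrite side_child -mulrA; congr (_ * _).
by rewrite mulrC -pmulrn divfK // pnatr_eq0 expn_eq0.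
Qed.

Lemma child_sub q N i : dyadic_cube R (@child q N i) `<=` dyadic_cube R q.
Proof.
rewrite !dyadic_cubeE => x H l; have := H l; rewrite corner_child !mxE.
have s0 := side_gt0 (child q i).
have : ((i l).+1%:R : R) <= (2 ^ N)%:R by rewrite ler_nat.
rewrite -(ler_pM2r s0) {2}side_child mulrCA divff ?mulr1 ?pnatr_eq0 ?expn_eq0 //.
have : 0 <= (i l)%:R * side R (child q i) by rewrite mulr_ge0 // ltW.
by rewrite -natr1 mulrDl mul1r => ? ? /andP[? ?]; apply/andP; split; lra.
Qed.

Lemma child_cover q N : dyadic_cube R q `<=` \bigcup_i dyadic_cube R (@child q N i).
Proof.
move=> x; rewrite dyadic_cubeE => H.
have s0 := side_gt0 q; have N0 : 0 < ((2 ^ N)%:R : R) by rewrite ltr0n expn_gt0.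
pose w := side R q / (2 ^ N)%:R; have w0 : 0 < w by rewrite divr_gt0.
have k0 : (0 < 2 ^ N)%N by rewrite expn_gt0.
(* The cap assigns the points of the far faces to the last child. *)
pose a l := minn (Num.truncn ((x 0 l - corner q 0 l) / w)) (2 ^ N).-1.
have aN l : (a l < 2 ^ N)%N by rewrite -[X in (_ < X)%N](prednK k0) ltnS geq_minr.
exists [ffun l => Ordinal (aN l)] => //; rewrite dyadic_cubeE => l.
rewrite corner_child [const_mx _ 0 l]mxE side_child -/w ffunE /=.
have /andP[x1 x2] := iffLR (cubeP _ _ _) H l.
have y0 : 0 <= (x 0 l - corner q 0 l) / w by rewrite divr_ge0 ?subr_ge0 // ltW.
have /andP[t1 t2] := truncn_itv y0.
have A : (a l)%:R * w <= x 0 l - corner q 0 l.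
  by rewrite -ler_pdivlMr //; apply: le_trans t1; rewrite ler_nat geq_minl.
have B : x 0 l - corner q 0 l <= (a l)%:R * w + w.
  have -> : (a l)%:R * w + w = (a l).+1%:R * w by rewrite -natr1 mulrDl mul1r.
  rewrite -ler_pdivrMr // /a /minn.
  case: ifP => _; first exact: ltW.
  rewrite prednK // ler_pdivrMr // /w mulrC divfK ?gt_eqF //; lra.
by apply/andP; split; lra.
Qed.

(** Contains the interior of the closed cube by [interior_dyadic_cube]; disjointness is checked on
    these explicit inequalities. *)
Definition open_cube q : set V := [set x | forall i,
  corner q 0 i < x 0 i < corner q 0 i + side R q].

Lemma open_child_sub q N i : open_cube (@child q N i) `<=` open_cube q.
Proof.
move=> x H l; have := H l; rewrite corner_child.
have s0 := side_gt0 (child q i).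
have : ((i l).+1%:R : R) <= (2 ^ N)%:R by rewrite ler_nat.
rewrite -(ler_pM2r s0) {2}side_child mulrCA divff ?mulr1 ?pnatr_eq0 ?expn_eq0 //.
have : 0 <= (i l)%:R * side R (child q i) by rewrite mulr_ge0 // ltW.
by rewrite -natr1 mulrDl mul1r => ? ? /andP[? ?]; apply/andP; split; lra.
Qed.

Lemma open_child_inj q N i j x :
  open_cube (@child q N i) x -> open_cube (@child q N j) x -> i = j.
Proof.
move=> Hi Hj; apply/ffunP => l; apply/val_inj/eqP.
have s0 := side_gt0 (child q i).
have sE : side R (child q j) = side R (child q i) by rewrite !side_child.
have := Hi l; have := Hj l; rewrite !corner_child sE => /andP[j1 j2] /andP[i1 i2].
have lt (a b : nat) : (a < b)%N -> a%:R * side R (child q i) + side R (child q i)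
    <= b%:R * side R (child q i).
  by move=> ab; rewrite -[X in _ + X]mul1r -mulrDl natr1 ler_pM2r // ler_nat.
by case: (ltngtP (i l) (j l)) => // /lt ?; exfalso; lra.
Qed.

Lemma interior_dyadic_cube q : interior (dyadic_cube R q) `<=` open_cube q.
Proof.
move=> x /nbhs_ballP[e /= e0 H] i.
have mem (t : R) : `|t| < e -> dyadic_cube R q (x + const_mx t).
  move=> te; apply: H; rewrite -ball_normE /= opprD addNKr normrN.
  apply: le_lt_trans te; apply: norm_le => // l; by rewrite mxE.
have e2 : `|e / 2| < e by rewrite gtr0_norm; lra.
have e2' : `|- (e / 2)| < e by rewrite normrN.
have := mem _ e2 ; have := mem _ e2'; rewrite dyadic_cubeE => /(_ i) + /(_ i).
by rewrite !mxE => /andP[? ?] /andP[? ?]; apply/andP; split; lra.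
Qed.

(** Take the least [N] for which two grid steps fit into [r]: then a whole grid cell fits into the
    cube, and minimality gives the factor 4. The bound on [N] keeps the relative volume of the child
    away from 0. *)
Lemma child_in_cube q p (r : R) : 0 < r -> r <= side R q ->
    cube p r `<=` dyadic_cube R q ->
  exists N (i : {ffun 'I_D -> 'I_(2 ^ N)}),
    [/\ dyadic_cube R (child q i) `<=` cube p r, r <= 4 * side R (@child q N i)
      & (N <= (Num.truncn (2 * side R q / r)).+1)%N].
Proof.
move=> r0 rs pq; have s0 := side_gt0 q.
pose P N := 2 * side R q <= r * (2 ^ N)%:R.
have P0 : P (Num.truncn (2 * side R q / r)).+1.
  rewrite /P [leRHS]mulrC -ler_pdivrMr //.
  apply: le_trans (ltW (truncnS_gt _)) _; rewrite ler_nat ltnW //; exact: ltn_expl.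
have exP : exists N, P N by eexists; exact: P0.
case: (ex_minnP exP) => N PN minN; exists N.
have N0 : 0 < ((2 ^ N)%:R : R) by rewrite ltr0n expn_gt0.
have r4 : r <= 4 * (side R q / (2 ^ N)%:R).
  case: N minN N0 {PN} => [|N] minN N0; first by rewrite expn0 divr1; lra.
  have : ~~ P N by apply/negP => /minN; rewrite ltnn.
  rewrite -ltNge => H; rewrite mulrA ler_pdivlMr // expnS natrM; lra.
pose w := side R q / (2 ^ N)%:R; have w0 : 0 < w by rewrite divr_gt0.
have wr : w *+ 2 <= r by rewrite -mulr_natl mulrA ler_pdivrMr.
have wN : (2 ^ N)%:R * w = side R q by rewrite mulrC divfK ?gt_eqF.
have pc l : corner q 0 l <= p 0 l /\ p 0 l + r <= corner q 0 l + side R q.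
  have /pq : cube p r p by apply/cubeP => k; rewrite lexx lerDl ltW.
  have /pq : cube p r (p + const_mx r).
    by apply/cubeP => k; rewrite !mxE lexx andbT lerDl ltW.
  rewrite dyadic_cubeE => /cubeP/(_ l) + /cubeP/(_ l).
  by rewrite [(p + _) 0 l]mxE [const_mx r 0 l]mxE => /andP[_ ->] /andP[->].
pose a l := (Num.truncn ((p 0 l - corner q 0 l) / w)).+1.
have aw l : p 0 l - corner q 0 l <= (a l)%:R * w <= p 0 l - corner q 0 l + w.
  have [c1 c2] := pc l.
  have y0 : 0 <= (p 0 l - corner q 0 l) / w by rewrite divr_ge0 ?subr_ge0 // ltW.
  have /andP[t1 t2] := truncn_itv y0; apply/andP; split.
    by rewrite -ler_pdivrMr // ltW.
  by rewrite /a -natr1 mulrDl mul1r lerD2r -ler_pdivlMr.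
have aN l : (a l < 2 ^ N)%N.
  rewrite -(ler_nat R) -(ler_pM2r w0) wN -natr1 mulrDl mul1r.
  by have [c1 c2] := pc l; have /andP[? ?] := aw l; lra.
exists [ffun l => Ordinal (aN l)]; split; last exact: minN P0.
  rewrite dyadic_cubeE => x /cubeP cx; apply/cubeP => l.
  have := cx l; rewrite corner_child side_child -/w ffunE /=.
  by have /andP[? ?] := aw l => /andP[? ?]; apply/andP; split; lra.
by rewrite side_child.
Qed.
End Dyadic.

Section Subdivision.
Variables (R : realType) (D : nat) (h : dyadic_index D -> R -> Prop) (m : nat).

(* [subdivided q theta]: some finite dyadic subdivision of the cube [q] has
   [h]-weights [t] with [\sum t * side ^+ m <= theta]. *)
Inductive subdivided : dyadic_index D -> R -> Prop :=
| Undivided q t theta : h q t -> t * side R q ^+ m <= theta -> subdivided q theta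
| Divided q N (t : {ffun 'I_D -> 'I_(2 ^ N)} -> R) theta :
    (forall i, subdivided (child q i) (t i)) -> \sum_i t i <= theta -> subdivided q theta.
Lemma subdivided_le q a b : a <= b -> subdivided q a -> subdivided q b.
Proof.
move=> + H; case: H => [q' t th ht tt|q' N t th Ht tt] ab.
  by apply: Undivided ht (le_trans tt ab).
exact: Divided Ht (le_trans tt ab).
Qed.
End Subdivision.

(** * Geometric decay under repeated subdivision *)

Section Iteration.
Variables (R : realType) (n m : nat) (C : R).
Notation D := (n + m)%N.
Notation V := 'rV[R]_D.
Variable d : V -> V -> R.
Hypotheses (dP : pmetric C d) (dN : nonseparated n (unit_cube R D) d).

Let h (q : dyadic_index D) t := thin n d (dyadic_cube R q) t.
(** The factor 2 provides the strict inequality in [thin]. *)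
Let C0 : R := 2 * (`|C| + 1) ^+ n.

Lemma thin_dyadic_cube q : h q (C0 * side R q ^+ n).
Proof.
have s0 := side_gt0 R q; have C1 : 0 < `|C| + 1 by rewrite ltr_wpDl.
apply: (@thin_finType R D n unit d _ (fun=> setT) (fun=> (`|C| + 1) * side R q)).
- by move=> _; rewrite mulr_ge0 ?ltW.
- by move=> x _; exists tt.
- move=> _ x y; rewrite dyadic_cubeE => /cubeP cx /cubeP cy _ _.
  apply: le_trans (pm_lip dP _ _) _.
  apply: le_trans (_ : (`|C| + 1) * `|x - y| <= _).
    by rewrite ler_wpM2r // (le_trans (ler_norm _)) // lerDl.
  rewrite ler_pM2l //; apply: norm_le => [|i]; first exact: ltW.
  by have := cx i; have := cy i; rewrite !mxE ler_norml => /andP[? ?] /andP[? ?]; lra.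
- rewrite sumr_const card_unit mulr1n exprMn /C0 ltr_pM2r ?exprn_gt0 //.
  by rewrite ltr_pMl ?exprn_gt0 // ltr1n.
Qed.

Lemma thin_child (eps : R) : 0 < eps -> exists N0, forall q,
  dyadic_cube R q `<=` unit_cube R D ->
  exists N (i : {ffun 'I_D -> 'I_(2 ^ N)}),
    (N <= N0)%N /\ h (child q i) (eps * side R (child q i) ^+ n).
Proof.
(* The child found may be smaller than the thin subcube by a factor of 4 in side. *)
move=> eps0; have e4 : 0 < eps / 4 ^+ n by rewrite divr_gt0 // exprn_gt0.
have [rho rho0 H] := @thin_subcube R D n C _ e4.
exists (Num.truncn (2 / rho)).+1 => q; rewrite dyadic_cubeE => qu.
have s0 := side_gt0 R q.
have [p [r [rr rs pq tp]]] := H d _ _ dP dN s0 qu.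
have r0 : 0 < r by rewrite (lt_le_trans _ rr) // mulr_gt0.
rewrite -dyadic_cubeE in pq; have [N [i [ip ir iN]]] := child_in_cube r0 rs pq.
exists N, i; split.
  apply: leq_trans iN _; rewrite ltnS; apply: le_truncn.
  by rewrite ler_pdivrMr // mulrAC ler_pdivlMr // -mulrA ler_pM2l // mulrC.
apply: thin_sub ip _ tp; rewrite -mulrA ler_pM2l // mulrC ler_pdivrMr ?exprn_gt0 //.
have s40 : 0 <= side R (child q i) * 4 by rewrite mulr_ge0 // ltW // side_gt0.
by rewrite -exprMn lerXn2r ?nnegrE ?(ltW r0) // mulrC.
Qed.

(** Each cube has a good child that fills at least the fraction (2 ^ N0) ^ -D of its volume. Keeping
    this child and subdividing the others again multiplies the cost of the bad part by at most [gam]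
    in each round. *)
Lemma subdivided_iter (eps : R) N0 k q : 0 < eps ->
  (forall q, dyadic_cube R q `<=` unit_cube R D ->
    exists N (i : {ffun 'I_D -> 'I_(2 ^ N)}),
      (N <= N0)%N /\ h (child q i) (eps * side R (child q i) ^+ n)) ->
  dyadic_cube R q `<=` unit_cube R D ->
  subdivided h m q ((eps + C0 * (1 - ((2 ^ N0)%:R ^- D)) ^+ k) * side R q ^+ D).
Proof.
move=> eps0 H; set gam := 1 - _.
have C00 : 0 < C0 by rewrite mulr_gt0 // exprn_gt0 // ltr_wpDl.
have g0 : 0 <= gam.
  by rewrite subr_ge0 invf_le1 ?exprn_gt0 ?exprn_ege1 ?ler1n ?ltr0n ?expn_gt0.
elim: k q => [|k IH] q qu; have s0 := side_gt0 R q.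
  apply: (Undivided (thin_dyadic_cube q)).
  rewrite -mulrA -exprD expr0 mulr1 ler_pM2r ?exprn_gt0 //; lra.
have [N [i0 [NN0 hi0]]] := H q qu.
pose b := eps + C0 * gam ^+ k.
pose s' := side R (child q i0).
have sE (i : {ffun 'I_D -> 'I_(2 ^ N)}) : side R (child q i) = s' by rewrite /s' !side_child.
apply: (@Divided _ _ _ _ q N (fun i => (if i == i0 then eps else b) * s' ^+ D)).
  move=> i; case: eqVneq => [->|_].
    by apply: (Undivided hi0); rewrite -/s' -mulrA -exprD.
  by rewrite -(sE i); apply: IH; exact: subset_trans (@child_sub _ _ _ _ _) qu.
rewrite -mulr_suml (bigD1 i0) //= eqxx.
rewrite (eq_bigr (fun=> b)) => [|i /negPf -> //].
have N0' : 0 < ((2 ^ N)%:R : R) by rewrite ltr0n expn_gt0.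
have N00' : 0 < ((2 ^ N0)%:R : R) by rewrite ltr0n expn_gt0.
have ss : s' ^+ D * (2 ^ N)%:R ^+ D = side R q ^+ D.
  by rewrite -exprMn /s' side_child divfK // gt_eqF.
have -> : eps + \sum_(i | i != i0) b = b * ((2 ^ N)%:R ^+ D) - C0 * gam ^+ k.
  have -> : b * ((2 ^ N)%:R ^+ D) = \sum_(i : {ffun 'I_D -> 'I_(2 ^ N)}) b.
    by rewrite sumr_const card_ffun !card_ord -natrX mulr_natr.
  by rewrite [in RHS](bigD1 i0) //= /b; ring.
have le : side R q ^+ D / (2 ^ N0)%:R ^+ D <= s' ^+ D.
  rewrite -ss ler_pdivrMr ?exprn_gt0 // ler_pM2l ?exprn_gt0 ?side_gt0 //.
  by rewrite lerXn2r ?nnegrE ?(ltW N0') ?(ltW N00') // ler_nat leq_exp2l.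
have -> : (b * (2 ^ N)%:R ^+ D - C0 * gam ^+ k) * s' ^+ D =
    b * side R q ^+ D - C0 * gam ^+ k * s' ^+ D by rewrite -ss; ring.
have -> : (eps + C0 * gam ^+ k.+1) * side R q ^+ D =
    b * side R q ^+ D - C0 * gam ^+ k * (side R q ^+ D / (2 ^ N0)%:R ^+ D).
  by rewrite /b exprS; move: (gam ^+ k) => u; rewrite /gam; ring.
by rewrite lerD2l lerN2 ler_wpM2l // mulr_ge0 ?exprn_ge0 // ltW.
Qed.

Lemma subdivided_unit_cube q (theta : R) : 0 < theta ->
  dyadic_cube R q `<=` unit_cube R D ->
  subdivided h m q (theta * side R q ^+ D).
Proof.
move=> t0 qu; have t2 : 0 < theta / 2 by rewrite divr_gt0.
have [N0 H] := thin_child t2.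
have C00 : 0 < C0 by rewrite mulr_gt0 // exprn_gt0 // ltr_wpDl.
have := subdivided_iter _ t2 H qu; set gam := 1 - _ => S.
have g0 : 0 <= gam.
  by rewrite subr_ge0 invf_le1 ?exprn_gt0 ?exprn_ege1 ?ler1n ?ltr0n ?expn_gt0.
have g1 : gam < 1 by rewrite gtrBl invr_gt0 exprn_gt0 // ltr0n expn_gt0.
have [k kt] : exists k, gam ^+ k < theta / 2 / C0.
  have : `|gam| < 1 by rewrite ger0_norm.
  move=> /cvg_expr/(cvgr_lt _) /(_ (theta / 2 / C0)) H'.
  have [|k _ Hk] := H'; first by rewrite divr_gt0.
  by exists k; apply: Hk => /=.
have le : (theta / 2 + C0 * gam ^+ k) * side R q ^+ D <= theta * side R q ^+ D.
  rewrite ler_pM2r ?exprn_gt0 ?side_gt0 //.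
  by move: kt; rewrite ltr_pdivlMr // mulrC; lra.
exact: subdivided_le le (S k).
Qed.
End Iteration.

(** * Upper bounds for the contents *)

Section Esum.
Local Open Scope ereal_scope.
Variable R : realType.

Lemma esum_subset (T : choiceType) (P Q : set T) (a : T -> \bar R) :
  P `<=` Q -> \esum_(t in P) a t <= \esum_(t in Q) a t.
Proof.
move=> PQ; apply: ge_ereal_sup => _ [X [fX XP] <-]; apply: esum_ge.
by exists X => //; split=> //; exact: subset_trans PQ.
Qed.

(** As [e] may fail to be injective, the left sum is reindexed by a section of [e], whose image is a
    subset of [P]. *)
Lemma esum_image_le (I T : choiceType) (P : set I) (e : I -> T) (a : T -> \bar R) :
  \esum_(t in e @` P) a t <= \esum_(i in P) a (e i).
Proof.
have [->|/set0P[i0 Pi0]] := eqVneq P set0; first by rewrite image_set0 !esum_set0.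
have /choice[s sP] : forall t, exists i, (e @` P) t -> P i /\ e i = t.
  move=> t; have [[i Pi <-]|nt] := pselect ((e @` P) t); first by exists i.
  by exists i0 => /nt.
rewrite (reindex_esum (s @` (e @` P)) (e @` P) e).
  by apply: esum_subset => _ [t et <-]; have [] := sP t et.
split.
- by move=> _ [t et <-]; have [_ ->] := sP t et.
- move=> i j; rewrite !inE => -[t et <-] [u eu <-].
  by have [_ ->] := sP t et; have [_ ->] := sP u eu => ->.
- by move=> t et; exists (s t); [exists t|have [_ ->] := sP t et].
Qed.

Lemma esum_bigcup_le (I T : choiceType) (K : set I) (J : I -> set T) (a : T -> \bar R) :
  (forall t, 0 <= a t) ->
  \esum_(t in \bigcup_(i in K) J i) a t <= \esum_(i in K) \esum_(t in J i) a t.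
Proof.
move=> a0; rewrite (esum_esum (a := fun _ t => a t)) //.
apply: le_trans (esum_image_le (K `*`` J) snd a); apply: esum_subset.
by move=> t [i Ki Jt]; exists (i, t).
Qed.

Lemma esum_finType (I : finType) (a : I -> \bar R) : (forall i, 0 <= a i) ->
  \esum_(i in [set: I]) a i = \sum_i a i.
Proof.
move=> a0; rewrite esum_fset //; last exact: finite_finset.
rewrite (fsbigE (enum I)) ?enum_uniq // => [|i _]; last by rewrite mem_enum.
by rewrite big_enum_cond; apply: eq_bigl => i; rewrite in_setT.
Qed.

Lemma esum_mulr_le (T : choiceType) (P : set T) (a : T -> \bar R) (s : R) :
  (0 <= s)%R -> (forall t, 0 <= a t) ->
  \esum_(t in P) (a t * s%:E) <= (\esum_(t in P) a t) * s%:E.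
Proof.
move=> s0 a0; apply: ge_ereal_sup => _ [X [fX XP] <-].
rewrite fsbig_finite //= -ge0_sume_distrl //.
apply: lee_wpmul2r; first by rewrite lee_fin.
by apply: esum_ge; exists X => //; rewrite fsbig_finite.
Qed.

Lemma esum_pickle_le (T : countType) (P : set T) (eta : R) : (0 <= eta)%R ->
  \esum_(t in P) (eta / (2 ^ (choice.pickle t).+1)%:R)%:E <= eta%:E.
Proof.
move=> eta0; pose g j := (eta / (2 ^ j.+1)%:R)%:E.
have g0 j : 0 <= g j by rewrite lee_fin divr_ge0.
rewrite -(esum_image P choice.pickle g); last by move=> x y _ _; exact: (pcan_inj choice.pickleK).
apply: le_trans (esum_subset _ (@subsetT _ _)) _.
rewrite -(@nneseries_esumT R) //; exact: epsilon_trick0.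
Qed.
End Esum.

Section HausdorffContentBounds.
Variables (R : realType) (X : metricType R).
Local Open Scope ereal_scope.

Lemma diam_ge0 (U : set X) : 0 <= diam U.
Proof. by apply: ereal_sup_ubound; left. Qed.

Lemma hausdorff_content_ge0 k (A : set X) : 0 <= hausdorff_content k A.
Proof.
apply: le_ereal_inf_tmp => _ [UU _ <-]; apply: esum_ge0 => U _.
exact/expe_ge0/diam_ge0.
Qed.
End HausdorffContentBounds.

Section ContentUpperBound.
Variables (R : realType) (n m : nat).
Notation D := (n + m)%N.
Notation V := 'rV[R]_D.
Notation X := (ell_infty R).
Variables (d : V -> V -> R) (f : V -> X).

(** The content asks for open covers, so the images of the pieces are replaced by their
    [eta]-neighbourhoods; this adds 2 eta to each diameter. *)
Lemma hausdorff_content_thin A t :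
  (forall x y, A x -> A y -> `|f x - f y| <= d x y) -> thin n d A t ->
  (hausdorff_content n (f @` A) <= t%:E)%E.
Proof.
move=> fd [N [F [r [r0 AF Fr rt]]]].
have [|eta eta0 H] := @horner_lt_near0 R (\sum_i ((r i)%:P + 2%:P * 'X) ^+ n) t.
  by rewrite horner_sum; under eq_bigr do rewrite !hornerE.
pose U i : set X := \bigcup_(x in A `&` F i) ball (f x) eta.
apply: le_trans (_ : \esum_(W in range U) diam W ^+ n <= _)%E.
  apply: ereal_inf_lbound; exists (range U) => //; split.
    by move=> _ [i _ <-]; apply: bigcup_open => x _; exact: ball_open.
  move=> _ [x Ax <-]; have [i _ Fx] := AF x Ax.
  by exists (U i); [exists i|exists x => //; exact: ballxx].
apply: le_trans (esum_image_le _ _ _) _.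
rewrite esum_finType => [|i]; last exact/expe_ge0/diam_ge0.
apply: le_trans (_ : (\sum_i (r i + 2 * eta) ^+ n)%:E <= _)%E; last first.
  by rewrite lee_fin ltW //; move: H; rewrite horner_sum; under eq_bigr do rewrite !hornerE.
rewrite -sumEFin; apply: lee_sum => i _.
have w0 : 0 <= r i + 2 * eta by rewrite addr_ge0 // mulr_ge0 // ltW.
have : (diam (U i) <= (r i + 2 * eta)%:E)%E.
  apply: ge_ereal_sup => _ [->|[[u v] [/= [x [Ax Fx] xu] [y [Ay Fy] yv]] <-]].
    by rewrite lee_fin.
  rewrite lee_fin; move: xu yv; rewrite -!ball_normE /= => xu yv.
  have -> : mdist u v = `|u - v| by [].
  have -> : u - v = - (f x - u) + ((f x - f y) + (f y - v)).
    by rewrite subrKA opprB subrKA.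
  apply: le_trans (ler_normD _ _) _; rewrite normrN.
  have := ler_normD (f x - f y) (f y - v); have := Fr i _ _ Ax Ay Fx Fy.
  have := fd _ _ Ax Ay; lra.
have := diam_ge0 (U i); case: (diam (U i)) => [a||] //; rewrite !lee_fin => a0 aw.
by rewrite -EFin_expe lee_fin lerXn2r.
Qed.

(** Induction on the subdivision. The inclusion of open cubes is carried along because it yields
    disjointness between families in different children. *)
Lemma subdivided_covering q theta :
  (forall x y, unit_cube R D x -> unit_cube R D y -> `|f x - f y| <= d x y) ->
  dyadic_cube R q `<=` unit_cube R D ->
  subdivided (fun q => thin n d (dyadic_cube R q)) m q theta ->
  exists C : set (dyadic_index D), [/\
    forall q', C q' -> dyadic_cube R q' `<=` dyadic_cube R q /\
                       @open_cube R D q' `<=` @open_cube R D q,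
    dyadic_cube R q `<=` \bigcup_(q' in C) dyadic_cube R q',
    trivIset C (@open_cube R D)
    & (\esum_(q' in C) (hausdorff_content n (f @` dyadic_cube R q')
          * (side R q' ^+ m)%:E) <= theta%:E)%E].
Proof.
move=> fd + H; elim: H => {q theta} [q t theta ht tt|q N t theta _ IH tt] qu.
  exists [set q]; split.
  - by move=> _ ->; split; exact: subset_refl.
  - by move=> x qx; exists q.
  - by move=> i j -> ->.
  rewrite esum_set1; last first.
    by rewrite mule_ge0 ?hausdorff_content_ge0 // lee_fin exprn_ge0 // ltW // side_gt0.
  apply: le_trans (_ : (t * side R q ^+ m)%:E <= _)%E; last by rewrite lee_fin.
  rewrite EFinM lee_wpmul2r ?lee_fin ?exprn_ge0 ?(ltW (side_gt0 _ _)) //.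
  by apply: hausdorff_content_thin ht => x y qx qy; apply: fd; apply: qu.
have /choice[C CP] := fun i => IH i (subset_trans (@child_sub _ _ _ _ i) qu).
exists (\bigcup_(i in setT) C i); split.
- move=> q' [i _ Cq']; have [H1 _ _ _] := CP i; have [s1 s2] := H1 _ Cq'; split.
    exact: subset_trans (@child_sub _ _ _ _ i).
  exact: subset_trans (@open_child_sub _ _ _ _ i).
- move=> x /(@child_cover R D q N)[i _ xi]; have [_ H1 _ _] := CP i; have [q' Cq' q'x] := H1 _ xi.
  by exists q' => //; exists i.
- move=> q1 q2 [i _ C1] [j _ C2] [x [xq1 xq2]].
  have [H1 _ T _] := CP i; have [H2 _ _ _] := CP j.
  have [_ s1] := H1 _ C1; have [_ s2] := H2 _ C2.
  have ij := open_child_inj (s1 _ xq1) (s2 _ xq2); move: C2 s2; rewrite -ij => C2 _.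
  by apply: T => //; exists x.
apply: le_trans (esum_bigcup_le _ _ _) _ => [q'|].
  by rewrite mule_ge0 ?hausdorff_content_ge0 // lee_fin exprn_ge0 // ltW // side_gt0.
rewrite esum_finType => [|i]; last first.
  apply: esum_ge0 => q' _.
  by rewrite mule_ge0 ?hausdorff_content_ge0 // lee_fin exprn_ge0 // ltW // side_gt0.
apply: le_trans (_ : (\sum_i t i)%:E <= _)%E; last by rewrite lee_fin.
by rewrite -sumEFin; apply: lee_sum => i _; have [] := CP i.
Qed.

Definition unit_index : dyadic_index D := (0%N, 0).

Lemma unit_index_cube : dyadic_cube R unit_index = unit_cube R D.
Proof.
by apply/seteqP; split=> x H i; have := H i; rewrite /= mxE expr0 invr1 mul0r add0r mul1r.
Qed.

Lemma mapping_content_subdivided theta :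
  (forall x y, unit_cube R D x -> unit_cube R D y -> `|f x - f y| <= d x y) ->
  subdivided (fun q => thin n d (dyadic_cube R q)) m unit_index theta ->
  (mapping_content f (unit_cube R D) <= theta%:E)%E.
Proof.
move=> fd /(subdivided_covering fd)[|C [Csub Ccov Ctriv Ct]].
  by rewrite unit_index_cube.
rewrite unit_index_cube in Csub Ccov.
apply: le_trans Ct; apply: ereal_inf_lbound; exists C => //; split=> //.
  by move=> q /Csub[].
move=> q1 q2 C1 C2 [x [x1 x2]]; apply: Ctriv => //; exists x; split;
  exact: interior_dyadic_cube.
Qed.

Lemma mapping_content_ge0 (Y : metricType R) (g : V -> Y) E :
  (0 <= mapping_content g E)%E.
Proof.
apply: le_ereal_inf_tmp => _ [C _ <-]; apply: esum_ge0 => q _.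
by rewrite mule_ge0 ?hausdorff_content_ge0 // lee_fin exprn_ge0 // ltW // side_gt0.
Qed.
End ContentUpperBound.

(** * Lower bound for the mapping content *)

Lemma card_spread (R : realType) (K : nat) (A : {set 'I_K}) (w : R) : 0 <= w ->
  (forall i j, i \in A -> j \in A -> (j%:R : R) - i%:R <= w) -> #|A|%:R <= w + 1.
Proof.
move=> w0 Aw; have [->|/finset.set0Pn[i0 i0A]] := eqVneq A finset.set0.
  by rewrite cards0 addr_ge0.
case: (arg_minnP (fun i : 'I_K => i : nat) i0A) => i iA imin.
case: (arg_maxnP (fun i : 'I_K => i : nat) i0A) => j jA jmax.
have ij : (i <= j)%N by exact: imin.
apply: le_trans (_ : (j - i).+1%:R <= _); last first.
  by rewrite -natr1 natrB // lerD2r Aw.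
rewrite ler_nat cardE -(size_map (val : 'I_K -> nat)) -(size_iota i (j - i).+1).
apply: uniq_leq_size; first by rewrite (map_inj_uniq val_inj) enum_uniq.
move=> _ /mapP[k +] ->; rewrite mem_enum mem_iota => kA.
by have := imin k kA; have := jmax k kA => /=; lia.
Qed.

Section Counting.
Variables (R : realType) (D : nat) (C : R).
Notation V := 'rV[R]_D.
Variables (d : V -> V -> R) (p l : V) (I : {set 'I_D}) (c : R).
Hypotheses (dP : pmetric C d) (C0 : 0 <= C) (c0 : 0 < c) (l0 : forall i, 0 < l 0 i).
Hypothesis dsep : separating d p l I c.

Section Grid.
Variable K : nat.
Hypothesis K0 : (0 < K)%N.
Let KR0 : 0 < (K%:R : R). Proof. by rewrite ltr0n. Qed.

(** Indices are capped at [K]: the boundary conditions of the discrete theorem range over all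
    vectors of naturals, and their verification takes place in the box. *)
Let pt (v : 'I_D -> nat) : V := \row_i (p 0 i + (minn (v i) K)%:R / K%:R * l 0 i).

Let pt_box v : box p l (pt v).
Proof.
move=> i; rewrite mxE lerDl mulr_ge0 ?divr_ge0 ?(ltW (l0 i)) //= lerD2l.
by rewrite ler_piMl ?(ltW (l0 i)) // ler_pdivrMr // mul1r ler_nat geq_minr.
Qed.

(** The [d]-distance from [x] to the lower [k]-face of the box is less than [t], written without an
    infimum. *)
Definition near_face k x (t : R) :=
  exists w, [/\ box p l w, w 0 k = p 0 k & d x w < t].

(** Poincare-Miranda for the distances to the lower [I]-faces, on the slice fixed by the coordinates
    of [z] outside [I]: near some [x], each of these distances crosses the level prescribed by
    [z]. *)
Lemma near_face_grid (z : {ffun 'I_D -> 'I_K}) : exists x : V, [/\ box p l x,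
  forall i, i \notin I -> x 0 i = p 0 i + (z i)%:R / K%:R * l 0 i &
  forall k, k \in I -> exists v w, [/\ near_face k v ((z k).+1%:R / K%:R * c),
    ~ near_face k w ((z k).+1%:R / K%:R * c), `|x - v| <= `|l| / K%:R & `|x - w| <= `|l| / K%:R]].
Proof.
(* The successor makes all levels positive; they are at most [c], so the lower face lies below the
   level and the opposite one does not. *)
pose y k : R := (z k).+1%:R / K%:R * c.
have y0 k : 0 < y k by rewrite mulr_gt0 // divr_gt0.
have yc k : y k <= c.
  by rewrite ler_piMl ?(ltW c0) // ler_pdivrMr // mul1r ler_nat.
(* Outside [I] any function with the right boundary values will do. *)
pose b k v := if k \in I then `[< ~ near_face k (pt v) (y k) >] else v k == K.
have b0 k v : v k = 0%N -> b k v = false.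
  rewrite /b => vk; case: ifP => _; last by rewrite vk eq_sym; lia.
  apply/asboolP => H; apply: H; exists (pt v); split=> //; last by rewrite (pm_xx dP).
  by rewrite mxE vk min0n mul0r mul0r addr0.
have bK k v : v k = K -> b k v = true.
  rewrite /b => vk; case: ifP => [kI|_]; last by rewrite vk eqxx.
  apply/asboolP => -[w [bw wk]]; apply/negP; rewrite -leNgt (pm_sym dP).
  apply: le_trans (yc k) _; apply: (dsep kI) => //.
  by rewrite mxE vk minnn divff ?gt_eqF // mul1r.
have [u uz uI] := @discrete_poincare_miranda _ K I b (fun i => z i) b0 bK.
have uzI i : i \notin I -> u i = z i.
  by move=> iI; have := uz i; rewrite (negPf iI) => /eqP.
have close v : (forall j, (u j <= v j <= u j + (j \in I))%N) ->
    `|pt u - pt v| <= `|l| / K%:R.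
  move=> uv; apply: norm_le => [|i]; first by rewrite divr_ge0.
  rewrite !mxE opprD addrACA subrr add0r -mulrBl -mulrBl normrM normrM.
  rewrite normfV (ger0_norm (ltW KR0)) mulrAC ler_pM2r ?invr_gt0 //.
  rewrite -[leRHS]mul1r; apply: ler_pM => //; last exact: le_coord.
  have /andP[uv1 uv2] := uv i.
  have : (minn (u i) K <= minn (v i) K <= (minn (u i) K).+1)%N by lia.
  move=> /andP[m1 m2]; rewrite distrC -natrB // ger0_norm //.
  by rewrite (ler_nat R _ 1); lia.
exists (pt u); split=> // [i iI|k kI].
  rewrite mxE uzI // (minn_idPl _) //; exact: ltnW.
have [v [w [bv bw uv uw]]] := uI k kI.
exists (pt w), (pt v); split; try exact: close.
  by move: bw; rewrite /b kI => /asboolPn/contrapT.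
by move: bv; rewrite /b kI => /asboolP.
Qed.

Variables (A : finType) (O : A -> set V) (rho S : A -> R).
Hypotheses (rho0 : forall a, 0 <= rho a) (S0 : forall a, 0 <= S a).
Hypothesis cov : forall x, box p l x -> exists a, O a x.
Hypothesis Orho : forall a x y, O a x -> O a y -> forall k, k \in I -> d x y <= rho a.
Hypothesis OS : forall a x y, O a x -> O a y -> forall i, `|x 0 i - y 0 i| <= S a.

(** Choose a point for each of the K ^ D vectors [z], and a set [O a] containing it. Points in the
    same [O a] have levels, for [i] in [I], and positions, for the other [i], within bounded spread.
    So at most the product of the numbers of admissible values of [z i] fall into [O a]. *)
Lemma counting_grid : 1 <= \sum_a \prod_i
  (if i \in I then rho a / c + (2 * C * `|l| / c + 1) / K%:R else S a / l 0 i + K%:R^-1).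
Proof.
have /choice[ax axP] : forall z : {ffun 'I_D -> 'I_K}, exists ax : A * V, O ax.1 ax.2 /\
   [/\ box p l ax.2,
  forall i, i \notin I -> ax.2 0 i = p 0 i + (z i)%:R / K%:R * l 0 i &
  forall k, k \in I -> exists v w, [/\ near_face k v ((z k).+1%:R / K%:R * c),
    ~ near_face k w ((z k).+1%:R / K%:R * c), `|ax.2 - v| <= `|l| / K%:R & `|ax.2 - w| <= `|l| / K%:R]].
  move=> z; have [x Hx] := near_face_grid z; have [bx _ _] := Hx.
  by have [a Oa] := cov bx; exists (a, x).
pose Z a : {set {ffun 'I_D -> 'I_K}} := [set z | (ax z).1 == a]%SET.
pose B a i : {set 'I_K} := [set (z : {ffun 'I_D -> 'I_K}) i | z in Z a]%SET.
pose g a i : R := if i \in I then rho a / c + (2 * C * `|l| / c + 1) / K%:R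
  else S a / l 0 i + K%:R^-1.
have Bg a i : #|B a i|%:R <= K%:R * g a i.
  rewrite /g; case: ifPn => iI.
    have -> : K%:R * (rho a / c + (2 * C * `|l| / c + 1) / K%:R) =
        K%:R * (rho a + 2 * (C * (`|l| / K%:R))) / c + 1.
      by field; rewrite !gt_eqF.
    apply: card_spread.
      by rewrite divr_ge0 ?mulr_ge0 ?addr_ge0 ?mulr_ge0 ?divr_ge0 // ltW.
    move=> _ _ /imsetP[z + ->] /imsetP[z' + ->]; rewrite !inE => /eqP az /eqP az'.
    have [Oz [bz _ /(_ i iI)[v [_ [[t [bt tk vt]] _ zv _]]]]] := axP z.
    have [Oz' [bz' _ /(_ i iI)[_ [w [_ Nw _ zw]]]]] := axP z'.
    have dw : (z' i).+1%:R / K%:R * c <= d w t.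
      by rewrite leNgt; apply/negP => H; apply: Nw; exists t.
    rewrite az in Oz; rewrite az' in Oz'.
    have L u u' : `|u - u'| <= `|l| / K%:R -> d u u' <= C * (`|l| / K%:R).
      by move=> H; apply: le_trans (pm_lip dP _ _) _; rewrite ler_wpM2l.
    have h : (z' i).+1%:R / K%:R * c - (z i).+1%:R / K%:R * c
        <= rho a + 2 * (C * (`|l| / K%:R)).
      have := pm_tri dP (ax z').2 w t; have := pm_tri dP (ax z).2 (ax z').2 t.
      have := pm_tri dP v (ax z).2 t; have := L _ _ zv; have := L _ _ zw.
      have := Orho Oz' Oz iI; rewrite (pm_sym dP w (ax z').2); lra.
    rewrite ler_pdivlMr // -ler_pdivrMl //; apply: le_trans h.
    by rewrite -!natr1 le_eqVlt; apply/orP; left; apply/eqP; field; rewrite gt_eqF.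
  have -> : K%:R * (S a / l 0 i + K%:R^-1) = K%:R * S a / l 0 i + 1.
    by field; rewrite !gt_eqF.
  apply: card_spread; first by rewrite divr_ge0 ?mulr_ge0 // ltW.
  move=> _ _ /imsetP[z + ->] /imsetP[z' + ->]; rewrite !inE => /eqP az /eqP az'.
  have [Oz [_ /(_ i iI) xz _]] := axP z; have [Oz' [_ /(_ i iI) xz' _]] := axP z'.
  rewrite az in Oz; rewrite az' in Oz'.
  rewrite ler_pdivlMr // -ler_pdivrMl //; apply: le_trans (OS Oz' Oz i).
  apply: le_trans (ler_norm _); rewrite xz xz'.
  by rewrite le_eqVlt; apply/orP; left; apply/eqP; field; rewrite gt_eqF.
have cardz : (K ^ D = \sum_a #|Z a|)%N.
  rewrite -[X in (X ^ _)%N]card_ord -[X in (_ ^ X)%N]card_ord -card_ffun -sum1_card.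
  rewrite (partition_big (fun z => (ax z).1) xpredT) //=.
  by apply: eq_bigr => a _; rewrite sum1dep_card.
have cardB a : (#|Z a| <= \prod_i #|B a i|)%N.
  rewrite -[X in (_ <= X)%N](_ : #|family (fun i => mem (B a i))| = _)%N; last first.
    by rewrite card_family foldrE big_map big_enum.
  apply: subset_leq_card; apply/fintype.subsetP => z zA; apply/familyP => i.
  by apply/imsetP; exists z.
have KD0 : 0 < (K%:R : R) ^+ D by rewrite exprn_gt0.
rewrite -(ler_pM2l KD0) mulr1 mulr_sumr.
apply: le_trans (_ : \sum_a #|Z a|%:R <= _).
  by rewrite -natr_sum -cardz natrX.
apply: ler_sum => a _; apply: le_trans (_ : (\prod_i #|B a i|)%:R <= _).
  by rewrite ler_nat.
rewrite natr_prod.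
rewrite -[X in _ ^+ X](card_ord D) -prodr_const -big_split /=.
by apply: ler_prod => i _; rewrite ler0n Bg.
Qed.
End Grid.

(** The limit of [counting_grid] as [K] grows: were the sum less than 1, it would stay so after a
    small error [eta] in every factor, contradicting the grid bound with 1 / K at most [eta]. *)
Lemma counting_bound (A : finType) (O : A -> set V) (rho S : A -> R) :
  (forall a, 0 <= rho a) -> (forall a, 0 <= S a) ->
  (forall x, box p l x -> exists a, O a x) ->
  (forall a x y, O a x -> O a y -> forall k, k \in I -> d x y <= rho a) ->
  (forall a x y, O a x -> O a y -> forall i, `|x 0 i - y 0 i| <= S a) ->
  1 <= \sum_a \prod_i (if i \in I then rho a / c else S a / l 0 i).
Proof.
move=> rho0 S0 cov Orho OS; rewrite leNgt; apply/negP.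
pose M := 2 * C * `|l| / c + 1.
have M0 : 0 < M by rewrite ltr_wpDl // divr_ge0 ?mulr_ge0 // ltW.
pose P := \sum_a \prod_i
  (if i \in I then (rho a / c)%:P + M%:P * 'X else (S a / l 0 i)%:P + 'X).
have PE e : P.[e] = \sum_a \prod_i
    (if i \in I then rho a / c + M * e else S a / l 0 i + e).
  rewrite horner_sum; apply: eq_bigr => a _; rewrite horner_prod.
  by apply: eq_bigr => i _; case: ifP => _; rewrite !hornerE.
move=> H; have {}H : P.[0] < 1.
  rewrite PE; apply: le_lt_trans H; rewrite le_eqVlt; apply/orP; left; apply/eqP.
  by apply: eq_bigr => a _; apply: eq_bigr => i _; rewrite mulr0 !addr0.
have [eta eta0] := horner_lt_near0 H; apply/negP; rewrite -leNgt PE.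
pose K := (Num.truncn eta^-1).+1.
have Ke : (K%:R : R)^-1 <= eta.
  by rewrite invf_ple ?posrE ?ltr0n // ltW // truncnS_gt.
apply: le_trans (@counting_grid K isT A O rho S rho0 S0 cov Orho OS) _.
apply: ler_sum => a _; apply: ler_prod => i _; case: ifP => _.
  rewrite addr_ge0 ?divr_ge0 ?ler0n ?(ltW c0) ?(ltW M0) //=.
  by rewrite lerD2l ler_pM2l.
by rewrite addr_ge0 ?divr_ge0 ?invr_ge0 ?ler0n ?(ltW (l0 i)) //= lerD2l.
Qed.
End Counting.

(** * Pseudometrics of Lipschitz maps *)

Section Pullback.
Variables (R : realType) (D : nat).
Notation V := 'rV[R]_D.
Notation X := (ell_infty R).

Definition clamp (x : V) : V := \row_i Num.max 0 (Num.min 1 (x 0 i)).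

Lemma clamp_unit x : unit_cube R D (clamp x).
Proof. by move=> i; rewrite mxE le_max lexx /= ge_max ler01 ge_min lexx. Qed.

Lemma clamp_id x : unit_cube R D x -> clamp x = x.
Proof.
move=> ux; apply/rowP => i; rewrite mxE; have /andP[x0 x1] := ux i.
by rewrite (min_idPr x1) (max_idPr x0).
Qed.

Lemma clamp_lip x y i : `|clamp x 0 i - clamp y 0 i| <= `|x 0 i - y 0 i|.
Proof.
have cl (t : R) : Num.max 0 (Num.min 1 t) = if t < 0 then 0 else if 1 < t then 1 else t.
  case: ltP => [t0|t0]; first by rewrite max_l // ge_min (ltW t0) orbT.
  by case: ltP => [t1|t1]; rewrite max_r.
rewrite !mxE !cl; move: (x 0 i) (y 0 i) => a b.
have := ler_norm (a - b); have := ler_norm (b - a); rewrite (distrC b a).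
move: `|a - b| => e ? ?; rewrite ler_norml.
by case: (ltP a 0) => ?; case: (ltP b 0) => ?; case: (ltP 1 a) => ?;
  case: (ltP 1 b) => ?; lra.
Qed.

Lemma euclidean_dist_le (x y : V) : euclidean_dist x y <= D%:R * `|x - y|.
Proof.
have xy0 : 0 <= D%:R * `|x - y| by rewrite mulr_ge0.
rewrite -(ger0_norm xy0) -sqrtr_sqr; apply: ler_wsqrtr.
apply: le_trans (_ : \sum_(i < D) `|x - y| ^+ 2 <= _).
  apply: ler_sum => i _; rewrite -[leLHS]ger0_norm ?sqr_ge0 // normrX lerXn2r ?nnegrE //.
  by have := le_coord (x - y) i; rewrite !mxE.
rewrite sumr_const card_ord exprMn -[leLHS]mulr_natl ler_wpM2r ?sqr_ge0 //.
by rewrite -natrX ler_nat; case: D => // k; rewrite expnS expn1 leq_pmulr.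
Qed.

(** Retracting onto the cube first gives a pseudometric on the whole space, as [pmetric] demands. *)
Definition pull (f : V -> X) (x y : V) : R := `|f (clamp x) - f (clamp y)|.

Lemma pull_unit f (x y : V) : unit_cube R D x -> unit_cube R D y -> pull f x y = `|f x - f y|.
Proof. by move=> ux uy; rewrite /pull !clamp_id. Qed.

Lemma pmetric_pull (f : V -> X) : one_lipschitz f -> pmetric D%:R (pull f).
Proof.
move=> fl; split=> [x|x y|x y z|x y]; rewrite /pull.
- by rewrite subrr normr0.
- by rewrite distrC.
- exact: ler_distD.
- apply: le_trans (fl _ _ (clamp_unit x) (clamp_unit y)) _.
  apply: le_trans (euclidean_dist_le _ _) _; rewrite ler_wpM2l //.
  apply: norm_le => // i; have := clamp_lip x y i; rewrite !mxE => /le_trans; apply.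
  by have := le_coord (x - y) i; rewrite !mxE.
Qed.

Lemma one_lipschitz_continuous (f : V -> X) : one_lipschitz f -> continuous (f \o clamp).
Proof.
move=> fl x; have D1 : 0 < (D.+1%:R : R) by rewrite ltr0n.
apply: (iffRL (@cvgrPdist_le _ _ _ _ (nbhs_filter x) _ _)) => eps eps0.
apply/nbhs_ballP; exists (eps / D.+1%:R) => /=; first by rewrite divr_gt0.
move=> y; rewrite -ball_normE /= => xy.
apply: le_trans (pm_lip (pmetric_pull fl) x y) _.
apply: le_trans (_ : D.+1%:R * `|x - y| <= _).
  by rewrite ler_wpM2r // ler_nat.
by rewrite mulrC -ler_pdivlMr // ltW.
Qed.
End Pullback.
Arguments clamp {R D} x.

Lemma expeyn (R : realType) n : (0 < n)%N -> (+oo ^+ n = +oo :> \bar R)%E.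
Proof. by elim: n => // -[|n] IH _; rewrite ?expe1 // expeS IH // mulyy. Qed.

Lemma fine_expe_le (R : realType) n (x : \bar R) : (0 <= x)%E ->
  ((fine x ^+ n)%:E <= x ^+ n)%E.
Proof.
case: x => [x||] //= _; first by rewrite EFin_expe.
case: n => [|n]; first by rewrite expr0 expe0.
by rewrite expr0n; apply: expe_ge0; exact: leey.
Qed.

Section ContentLowerBound.
Variables (R : realType) (n m : nat).
Notation D := (n + m)%N.
Notation V := 'rV[R]_D.
Notation X := (ell_infty R).
Variables (f : V -> X) (p l : V) (I : {set 'I_D}) (c : R).
Hypotheses (fl : one_lipschitz f) (c0 : 0 < c) (l0 : forall i, 0 < l 0 i).
Hypotheses (In : #|I| = n) (bu : box p l `<=` unit_cube R D).
Hypothesis fsep : separating (pull f) p l I c.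

(** Combine a cheap dyadic covering with nearly optimal open covers of the images, pull these back
    to open sets of the domain, extract a finite cover of the box, and apply [counting_bound].
    Enlarging the dyadic cubes to open ones of triple side costs 3 ^ m. *)
Lemma mapping_content_separating :
  ((c ^+ n * \prod_(i | i \notin I) l 0 i / 3 ^+ m)%:E <= mapping_content f (unit_cube R D))%E.
Proof.
rewrite leNgt; apply/negP; set b := _ / _ => Hb.
have [_ [C [Cu Ccov Ctriv] <-]] := ereal_inf_lt Hb.
set E := esum _ _ => Eb.
pose H q := hausdorff_content n (f @` dyadic_cube R q).
have H0 q : (0 <= H q)%E by exact: hausdorff_content_ge0.
have s0 (q : dyadic_index D) : 0 < side R q by exact: side_gt0.
have sm0 (q : dyadic_index D) : 0 < side R q ^+ m by rewrite exprn_gt0.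
have E0 : (0 <= E)%E.
  by apply: esum_ge0 => q _; rewrite mule_ge0 ?hausdorff_content_ge0 // lee_fin ltW.
have [e Ee] : exists e : R, E = e%:E.
  by move: E0 Eb; case: E => [e||] // _ _; exists e.
rewrite Ee lte_fin in Eb; pose eta := (b - e) / 2.
have eta0 : 0 < eta by rewrite divr_gt0 // subr_gt0.
(* The errors allowed in the single covers add up to at most [eta]. *)
pose w (q : dyadic_index D) := eta / (2 ^ (choice.pickle q).+1)%:R.
have w0 q : 0 < w q by rewrite divr_gt0 // ltr0n expn_gt0.
have /choice[UU UUP] : forall q, exists UU : set (set X), C q ->
    [/\ UU `<=` open, f @` dyadic_cube R q `<=` \bigcup_(U in UU) U &
     (\esum_(U in UU) diam U ^+ n <= H q + (w q)%:E)%E].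
  move=> q; have [Cq|nC] := pselect (C q); last by exists set0 => /nC.
  (* An infinite content times a positive power of the side would exceed the finite total [E]. *)
  have Hfin : H q \is a fin_num.
    rewrite ge0_fin_numE // ltey; apply/eqP => Hy.
    have : (H q * (side R q ^+ m)%:E <= E)%E.
      apply: esum_ge; exists [set q]; first by split=> // _ ->.
      by rewrite fsbig_set1.
    by rewrite Hy Ee gt0_mulye ?lte_fin // leye_eq.
  have [_ [UU [Uo Uc] <-] Ul] := lb_ereal_inf_adherent (w0 q) Hfin.
  by exists UU => _; split=> //; exact: ltW.
pose P : set (dyadic_index D * set X) := C `*`` UU.
pose a (k : dyadic_index D * set X) := (diam k.2 ^+ n * (side R k.1 ^+ m)%:E)%E.
have a0 k : (0 <= a k)%E.
  apply: mule_ge0; last by rewrite lee_fin ltW.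
  exact/expe_ge0/diam_ge0.
have aP : (\esum_(k in P) a k <= (e + eta)%:E)%E.
  rewrite -(esum_esum (a := fun q U => diam U ^+ n * (side R q ^+ m)%:E)%E); last first.
    by move=> q U _ _; exact: (a0 (q, U)).
  apply: le_trans (_ : \esum_(q in C) (H q * (side R q ^+ m)%:E + (w q)%:E) <= _)%E.
    apply: le_esum => q Cq; have [_ _ Uq] := UUP q Cq.
    have := esum_mulr_le (UU q) (ltW (sm0 q)) (fun U : set X => expe_ge0 n (diam_ge0 U)).
    move=> /le_trans; apply.
    apply: le_trans (lee_wpmul2r _ Uq) _; first by rewrite lee_fin ltW.
    rewrite ge0_muleDl ?lee_fin ?(ltW (w0 q)) //; apply: leeD2l.
    by rewrite -EFinM lee_fin ler_piMr ?(ltW (w0 q)) // exprn_ile1 // ?(ltW (s0 q)) // side_le1.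
  rewrite esumD => [|q _|q _]; last 2 first.
  - by rewrite mule_ge0 // lee_fin ltW.
  - by rewrite lee_fin ltW.
  rewrite EFinD -Ee; apply: leeD2l; apply: esum_pickle_le; exact: ltW.
(* Open cubes of side [3 * side] around the closed cubes of the covering. *)
pose O (k : dyadic_index D * set X) : set V :=
  ball (corner R k.1 + const_mx (side R k.1 / 2)) (3 / 2 * side R k.1)
    `&` (f \o clamp) @^-1` k.2.
have Oo k : P k -> open (O k).
  move=> [Ck Uk]; apply: openI; first exact: ball_open.
  apply: open_comp => [x _|]; first exact: one_lipschitz_continuous.
  by have [/(_ _ Uk)] := UUP _ Ck.
have Ocov : box p l `<=` cover P O.
  move=> x /bu ux; have [q Cq qx] := Ccov x ux.
  have [_ /(_ (f x))Uc _] := UUP q Cq; have [|U Uq Ux] := Uc; first by exists x.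
  exists (q, U); first by split.
  split; last by rewrite /= clamp_id.
  rewrite -ball_normE /=; apply: le_lt_trans (_ : side R q / 2 < _); last first.
    by have := s0 q; lra.
  apply: norm_le => [|i]; first by rewrite divr_ge0 // ltW.
  move: qx; rewrite dyadic_cubeE => /cubeP/(_ i) /andP[].
  rewrite !mxE ler_norml => ? ?; apply/andP; split; lra.
have := @box_compact R D p l; rewrite compact_cover => cbox.
have [F FP Fcov] := cbox _ P O Oo Ocov.
have dP := pmetric_pull fl.
have Pk (k : F) : P (val k) by apply/set_mem/FP/fsvalP.
have ak (k : F) : (a (val k) <= (e + eta)%:E)%E.
  apply: le_trans aP; apply: esum_ge; exists [set val k]; first by split=> // _ ->.
  by rewrite fsbig_set1.
(* For n = 0 the weight of a set is 1 and does not bound its diameter; [I] is then empty and no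
   diameter bound is asked for. *)
have dfin (k : F) : (0 < n)%N -> diam (val k).2 \is a fin_num.
  move=> n0; rewrite ge0_fin_numE ?diam_ge0 // ltey; apply/eqP => dy.
  by have := ak k; rewrite /a dy expeyn // gt0_mulye ?lte_fin // leye_eq.
pose rho (k : F) := fine (diam (val k).2).
have rho0 k : 0 <= rho k by apply: fine_ge0; exact: diam_ge0.
pose S (k : F) := 3 * side R (val k).1.
have S0 k : 0 < S k by rewrite mulr_gt0.
have Ocov' x : box p l x -> exists k : F, O (val k) x.
  by move=> /Fcov[k kF Ox]; exists [` kF]%fset.
have Orho (k : F) x y : O (val k) x -> O (val k) y -> forall i, i \in I -> pull f x y <= rho k.
  move=> [_ Ux] [_ Uy] i iI; have n0 : (0 < n)%N by rewrite -In card_gt0; apply/finset.set0Pn; exists i.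
  rewrite -lee_fin fineK ?dfin //; apply: ereal_sup_ubound; right.
  by exists (f (clamp x), f (clamp y)).
have OS (k : F) x y : O (val k) x -> O (val k) y -> forall i, `|x 0 i - y 0 i| <= S k.
  move=> [+ _] [+ _] i; rewrite -!ball_normE /=; set z := corner _ _ + _ => zx zy.
  have := le_coord (z - x) i; have := le_coord (z - y) i.
  have := ler_distD (z 0 i) (x 0 i) (y 0 i); rewrite (distrC (x 0 i) (z 0 i)).
  rewrite [(z - x) 0 i]mxE [(z - y) 0 i]mxE [(- x) 0 i]mxE [(- y) 0 i]mxE /S; lra.
have := counting_bound dP (ler0n _ _) c0 l0 fsep rho0 (fun k => ltW (S0 k)) Ocov' Orho OS.
pose L := \prod_(i | i \notin I) l 0 i.
have L0 : 0 < L by apply: prodr_gt0.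
have cn0 : 0 < c ^+ n by rewrite exprn_gt0.
have mE : #|[pred i | i \notin I]| = m.
  by have := cardC (mem I); rewrite card_ord In => /addnI.
rewrite (eq_bigr (fun k => (rho k ^+ n * side R (val k).1 ^+ m) * (3 ^+ m / (c ^+ n * L)))) => [|k _].
  rewrite -mulr_suml; apply/negP; rewrite -ltNge.
  have : \sum_k (rho k ^+ n * side R (val k).1 ^+ m) <= e + eta.
    rewrite -lee_fin -sumEFin; apply: le_trans aP.
    apply: esum_ge; exists [set` F]; first by split=> // k /FP/set_mem.
    rewrite fsbig_finite //= set_fsetK big_seq_fsetE /=; apply: lee_sum => k _.
    rewrite EFinM /a lee_wpmul2r ?lee_fin ?(ltW (sm0 _)) // /rho.
    by rewrite fine_expe_le // diam_ge0.
  have q0 : 0 < 3 ^+ m / (c ^+ n * L) by rewrite divr_gt0 ?mulr_gt0 // exprn_gt0.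
  move=> H1; refine (le_lt_trans (ler_wpM2r (ltW q0) H1) _).
  have eb : e + eta < b by rewrite /eta; lra.
  apply: lt_le_trans (_ : b * (3 ^+ m / (c ^+ n * L)) <= _); first by rewrite ltr_pM2r.
  rewrite /b -/L; set T := 3 ^+ m; have T0 : T != 0 by rewrite expf_neq0.
  by rewrite le_eqVlt; apply/orP; left; apply/eqP; field; rewrite T0 !gt_eqF.
rewrite (bigID (mem I)) /=.
rewrite (eq_bigr (fun=> rho k / c)) => [|i ->//].
rewrite [X in _ * X](eq_bigr (fun i => S k / l 0 i)) => [|i /negPf ->//].
rewrite prodr_const In prodf_div prodr_const mE -/L /S expr_div_n exprMn.
by field; rewrite !gt_eqF.
Qed.
End ContentLowerBound.

(** * Compactness and conclusion *)

Section Extension.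
Variables (R : realType) (D : nat) (C : R).
Notation V := 'rV[R]_D.
Notation X := (ell_infty R).

(** McShane's formula in each coordinate: [h i] is an infimum of functions 1-Lipschitz for [d].
    Taking z = x bounds it above by [F], and the hypothesis bounds it below by [F] minus [delta]. *)
Lemma mcshane_perturbation (d : V -> V -> R) (F : V -> X) (delta : R) : pmetric C d ->
  (forall x y, unit_cube R D x -> unit_cube R D y -> `|F x - F y| <= d x y + delta) ->
  exists g : V -> X,
    (forall x y, unit_cube R D x -> unit_cube R D y -> `|g x - g y| <= d x y) /\
    (forall x, unit_cube R D x -> `|g x - F x| <= delta).
Proof.
move=> dP Fd; pose A i x := [set F z i + d x z | z in unit_cube R D].
pose h i x : R := inf (A i x).
have FdR i x y : unit_cube R D x -> unit_cube R D y -> F x i - F y i <= d x y + delta.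
  move=> ux uy; apply: le_trans (Fd _ _ ux uy).
  exact: le_trans (ler_norm _) (ell_infty_norm_ge (F x - F y) i).
have lbA i x : unit_cube R D x -> lbound (A i x) (F x i - delta).
  by move=> ux _ [z uz <-]; have := FdR i x z ux uz; lra.
have hA i x : unit_cube R D x -> has_inf (A i x).
  move=> ux; split; first by exists (F x i + d x x), x.
  by exists (F x i - delta); exact: lbA.
have h1 i x : unit_cube R D x -> F x i - delta <= h i x.
  by move=> ux; apply: lb_le_inf; [exact: (hA i x ux).1|exact: lbA].
have h2 i x : unit_cube R D x -> h i x <= F x i.
  move=> ux; apply: ge_inf; first exact: (hA i x ux).2.
  by exists x => //; rewrite (pm_xx dP) addr0.
have h3 i x y : unit_cube R D x -> unit_cube R D y -> h i x <= h i y + d x y.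
  move=> ux uy; rewrite -lerBlDr; apply: lb_le_inf; first exact: (hA i y uy).1.
  move=> _ [z uz <-]; rewrite lerBlDr; apply: le_trans (_ : F z i + d x z <= _).
    by apply: ge_inf; [exact: (hA i x ux).2|exists z].
  by rewrite -addrA lerD2l addrC; exact: pm_tri dP _ _ _.
have d0 : 0 <= delta.
  have := lbA 0%N (clamp 0) (clamp_unit 0) _ (ex_intro2 _ _ _ (clamp_unit 0) erefl).
  by rewrite (pm_xx dP); lra.
(* The retraction makes the sequence bounded also at points outside the cube. *)
have hb x : (fun i => h i (clamp x)) \in @bounded_seq R.
  apply/bounded_seqP; exists (`|F (clamp x)| + delta) => i.
  have := h1 i _ (clamp_unit x); have := h2 i _ (clamp_unit x).
  have : `|F (clamp x) i| <= `|F (clamp x)| := ell_infty_norm_ge (F (clamp x)) i.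
  by rewrite !ler_norml => /andP[? ?] ? ?; apply/andP; split; lra.
exists (fun x => EllInfty (hb x)); split.
  move=> x y ux uy; apply: ell_infty_norm_le => i.
  suff : `|h i (clamp x) - h i (clamp y)| <= d x y by [].
  rewrite !clamp_id //; have := h3 i x y ux uy; have := h3 i y x uy ux.
  by rewrite (pm_sym dP y) ler_norml; lra.
move=> x ux; apply: ell_infty_norm_le => i.
suff : `|h i (clamp x) - F x i| <= delta by [].
by rewrite clamp_id //; have := h1 i x ux; have := h2 i x ux; rewrite ler_norml; lra.
Qed.
End Extension.

Section Compactness.
Variables (R : realType) (n m : nat).
Notation D := (n + m)%N.
Notation V := 'rV[R]_D.
Notation X := (ell_infty R).
Variable U : set_system nat.
Hypothesis UU : UltraFilter U.

Lemma unit_cube_box : unit_cube R D = box 0 (const_mx 1).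
Proof. by apply/seteqP; split=> x H i; have := H i; rewrite !mxE add0r. Qed.

(** A subdivision involves finitely many thinness conditions, each of which passes to [U]-most
    [d_ j]. *)
Lemma subdivided_ulim (C : R) (d_ : nat -> V -> V -> R) d q theta :
  (forall j, pmetric C (d_ j)) -> pmetric C d -> ucvg U d_ d ->
  subdivided (fun q => thin n d (dyadic_cube R q)) m q theta ->
  \forall j \near U, subdivided (fun q => thin n (d_ j) (dyadic_cube R q)) m q theta.
Proof.
move=> dP dP' dd; elim=> {q theta} [q t theta ht tt|q N t theta _ IH tt].
  have qbox : dyadic_cube R q `<=` box (corner R q) (const_mx (side R q)).
    by rewrite dyadic_cubeE.
  apply: filterS (thin_ulim UU dP dP' dd qbox ht) => j Hj; exact: Undivided Hj tt.
have {}IH : \forall j \near U, forall i, subdivided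
    (fun q => thin n (d_ j) (dyadic_cube R q)) m (child q i) (t i).
  exact: filter_forall.
apply: filterS IH => j Hj; exact: Divided Hj tt.
Qed.

Variables (f_ : nat -> V -> X) (d : V -> V -> R).
Hypotheses (fl : forall j, one_lipschitz (f_ j)) (dP : pmetric D%:R d).
Hypothesis fd : ucvg U (fun j => pull (f_ j)) d.

(** A box separating for the limit is separating for [U]-most [f_ j] with half the constant, which
    bounds their contents below uniformly. *)
Lemma content_limit_nonseparated :
  (forall b : R, 0 < b ->
     \forall j \near U, (mapping_content (f_ j) (unit_cube R D) < b%:E)%E) ->
  nonseparated n (unit_cube R D) d.
Proof.
move=> Hb p l I c l0 In c0 bu /(separating_ulim UU (fun j => pmetric_pull (fl j)) dP fd c0) Sj.
pose b := (c / 2) ^+ n * \prod_(i | i \notin I) l 0 i / 3 ^+ m.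
have c20 : 0 < c / 2 by rewrite divr_gt0.
have b0 : 0 < b by rewrite divr_gt0 ?exprn_gt0 // mulr_gt0 ?exprn_gt0 //; exact: prodr_gt0.
have [j [sj]] := filter_ex (filterI Sj (Hb b b0)).
apply/negP; rewrite -leNgt.
exact: (mapping_content_separating (fl j) c20 l0 In bu sj).
Qed.

Lemma content_limit_subdivided theta : 0 < theta ->
  nonseparated n (unit_cube R D) d ->
  subdivided (fun q => thin n d (dyadic_cube R q)) m (unit_index n m) theta.
Proof.
move=> t0 dN; have := @subdivided_unit_cube R n m D%:R d dP dN (unit_index n m) _ t0.
by rewrite unit_index_cube /side expr0 invr1 expr1n mulr1; apply.
Qed.
End Compactness.

Section MainParts.
Variables (R : realType) (n m : nat).
Notation D := (n + m)%N.
Notation V := 'rV[R]_D.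
Notation X := (ell_infty R).

Lemma near_infty_natSinv_ltR (e : R) : 0 < e -> \forall j \near \oo, j.+1%:R^-1 < e.
Proof. by move=> e0; exact: near_infty_natSinv_lt (PosNum e0). Qed.

Lemma small_content_perturbation (eps : R) : 0 < eps ->
  exists2 delta : R, 0 < delta & forall f : V -> X, one_lipschitz f ->
    (mapping_content f (unit_cube R D) < delta%:E)%E ->
    exists g : V -> X, [/\ one_lipschitz g, (sup_dist g f < eps%:E)%E
      & mapping_content g (unit_cube R D) = 0%E].
Proof.
move=> eps0; apply: contrapT => H.
have {}H j : exists f : V -> X, [/\ one_lipschitz f,
    (mapping_content f (unit_cube R D) < (j.+1%:R^-1)%:E)%E &
    ~ exists g : V -> X, [/\ one_lipschitz g, (sup_dist g f < eps%:E)%E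
      & mapping_content g (unit_cube R D) = 0%E]].
  apply: contrapT => Hj; apply: H; exists j.+1%:R^-1; first by rewrite invr_gt0.
  move=> f fl fc; apply: contrapT => Hg; apply: Hj; by exists f.
have [f_ f_P] := choice H.
have fl j : one_lipschitz (f_ j) by case: (f_P j).
have [U UU Uoo] := ultrafilter_infty.
have [d dP fd] := pmetric_ulim UU (fun j => pmetric_pull (fl j)).
have dN : nonseparated n (unit_cube R D) d.
  apply: (content_limit_nonseparated UU fl dP fd) => b b0.
  have := Uoo _ (near_infty_natSinv_ltR b0); apply: filterS => j jb.
  by have [_ + _] := f_P j; move=> /lt_trans; apply; rewrite lte_fin.
(* The Euclidean bound passes to the limit separately, since [dP] only gives a cruder one in the max
   norm; it makes [g] 1-Lipschitz. *)
have de x y : unit_cube R D x -> unit_cube R D y -> d x y <= euclidean_dist x y.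
  move=> ux uy; apply: (cvgr_to_le (fd x y)); apply: filterE => j.
  by rewrite pull_unit //; exact: fl.
have e2 : 0 < eps / 2 by rewrite divr_gt0.
have cu : compact (unit_cube R D) by rewrite unit_cube_box; exact: box_compact.
have [j Hj] := filter_ex (ucvg_unif UU (fun j => pmetric_pull (fl j)) dP fd cu e2).
have [|g [gd gf]] := mcshane_perturbation (F := f_ j) (delta := eps / 2) dP.
  move=> x y ux uy; have := Hj x y ux uy; rewrite pull_unit // ler_norml; lra.
have [_ _] := f_P j; apply; exists g; split.
- by move=> x y ux uy; apply: le_trans (gd x y ux uy) (de x y ux uy).
- apply: le_lt_trans (_ : ((eps / 2)%:E < _)%E); last by rewrite lte_fin; lra.
  by apply: ge_ereal_sup => _ [x ux <-]; rewrite lee_fin gf.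
- apply/eqP; rewrite eq_le mapping_content_ge0 andbT.
  apply/lee_addgt0Pr => th th0; rewrite add0e.
  exact: mapping_content_subdivided gd (content_limit_subdivided dP th0 dN).
Qed.

Lemma near_zero_content (eps : R) : 0 < eps ->
  exists2 delta : R, 0 < delta & forall f g : V -> X,
    one_lipschitz f -> one_lipschitz g ->
    mapping_content g (unit_cube R D) = 0%E -> (sup_dist g f < delta%:E)%E ->
    (mapping_content f (unit_cube R D) < eps%:E)%E.
Proof.
move=> eps0; apply: contrapT => H.
have {}H j : exists fg : (V -> X) * (V -> X), [/\ one_lipschitz fg.1, one_lipschitz fg.2,
    mapping_content fg.2 (unit_cube R D) = 0%E,
    (sup_dist fg.2 fg.1 < (j.+1%:R^-1)%:E)%E &
    ~ (mapping_content fg.1 (unit_cube R D) < eps%:E)%E].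
  apply: contrapT => Hj; apply: H; exists j.+1%:R^-1; first by rewrite invr_gt0.
  move=> f g fl gl g0 fg; apply: contrapT => Hg; apply: Hj; by exists (f, g).
have [fg fgP] := choice H; pose f_ j := (fg j).1; pose g_ j := (fg j).2.
have fl j : one_lipschitz (f_ j) by case: (fgP j).
have gl j : one_lipschitz (g_ j) by case: (fgP j).
have [U UU Uoo] := ultrafilter_infty.
have [d dP gd] := pmetric_ulim UU (fun j => pmetric_pull (gl j)).
have dN : nonseparated n (unit_cube R D) d.
  apply: (content_limit_nonseparated UU gl dP gd) => b b0; apply: filterE => j.
  by have [_ _ -> _ _] := fgP j; rewrite lte_fin.
have close j x : `|g_ j (clamp x) - f_ j (clamp x)| <= j.+1%:R^-1.
  have [_ _ _ fgj _] := fgP j; rewrite -lee_fin; apply: le_trans (ltW fgj).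
  by apply: ereal_sup_ubound; exists (clamp x) => //; exact: clamp_unit.
(* The pseudometrics of [f_ j] and [g_ j] differ by at most 2 / (j + 1), so they have the same
   ultralimit, and the subdivisions obtained from the [g_ j] serve the [f_ j]. *)
have fd : ucvg U (fun j => pull (f_ j)) d.
  move=> x y; apply/cvgrPdist_le => e e0.
  have e4 : 0 < e / 4 by rewrite divr_gt0.
  have /cvgrPdist_le/(_ _ (divr_gt0 e0 (ltr0Sn R 1))) := gd x y.
  move=> /filterI/(_ (Uoo _ (near_infty_natSinv_ltR e4))).
  apply: filterS => j /= [gj je].
  have : `|pull (g_ j) x y - pull (f_ j) x y| <= e / 2.
    apply: le_trans (ler_dist_dist _ _) _.
    have -> : g_ j (clamp x) - g_ j (clamp y) - (f_ j (clamp x) - f_ j (clamp y)) =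
        (g_ j (clamp x) - f_ j (clamp x)) - (g_ j (clamp y) - f_ j (clamp y)).
      by rewrite !opprB addrACA [RHS]addrACA; congr (_ + _); exact: addrC.
    apply: le_trans (ler_normB _ _) _.
    have je' : (j.+1%:R : R)^-1 < e / 4 := je.
    have := close j x; have := close j y; move: (j.+1%:R^-1) je' => u; lra.
  move: gj; rewrite !ler_norml; lra.
have e2 : 0 < eps / 2 by rewrite divr_gt0.
have Sj := subdivided_ulim UU (fun j => pmetric_pull (fl j)) dP fd
  (content_limit_subdivided dP e2 dN).
have [j Hj] := filter_ex Sj.
have [_ _ _ _] := fgP j; apply.
apply: le_lt_trans (_ : ((eps / 2)%:E < _)%E); last by rewrite lte_fin; lra.
by apply: mapping_content_subdivided Hj => x y ux uy; rewrite pull_unit.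
Qed.
End MainParts.

Theorem theoremB (R : realType) (n m : nat) :
  (forall eps : R, 0 < eps ->
     exists2 delta : R, 0 < delta &
       forall f : 'rV[R]_(n + m) -> ell_infty R,
         one_lipschitz f ->
         (mapping_content f (unit_cube R (n + m)) < delta%:E)%E ->
         exists g : 'rV[R]_(n + m) -> ell_infty R,
           [/\ one_lipschitz g,
               (sup_dist g f < eps%:E)%E
             & mapping_content g (unit_cube R (n + m)) = 0%E])
  /\
  (forall eps' : R, 0 < eps' ->
     exists2 delta' : R, 0 < delta' &
       forall f g : 'rV[R]_(n + m) -> ell_infty R,
         one_lipschitz f -> one_lipschitz g ->
         mapping_content g (unit_cube R (n + m)) = 0%E ->
         (sup_dist g f < delta'%:E)%E ->
         (mapping_content f (unit_cube R (n + m)) < eps'%:E)%E).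
Proof.
by split=> eps eps0; [exact: small_content_perturbation|exact: near_zero_content].
Qed.
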